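(* Let $n\ge 1$. Every element of the inverse mapping class monoid $\mathcal{IM}_{0,n}$ can be written uniquely in the form $$(\sigma_{i_1}\sigma_{i_1-1}\cdots\sigma_1)(\sigma_{i_2}\cdots\sigma_2)\cdots(\sigma_{i_k}\cdots\sigma_k)\;\epsilon_{k+1,n}\,x\,\epsilon_{k+1,n}\;(\sigma_k\sigma_{k+1}\cdots\sigma_{j_k})\cdots(\sigma_1\sigma_2\cdots\sigma_{j_1}),$$ where $k\in\{0,\dots,n\}$, $0\le i_1<\dots<i_k\le n-1$, $0\le j_1<\dots<j_k\le n-1$, each block $\sigma_{i_r}\cdots\sigma_r$ (resp. $\sigma_r\cdots\sigma_{j_r}$) is the descending (resp. ascending) product of consecutive generators and is empty when $i_r=r-1$ (resp. $j_r=r-1$), and $x\in\mathcal{M}_{0,k}$ is an element of the mapping class group of the sphere with the $k$ marked points $q_1,\dots,q_k$ (a word in $\sigma_1^{\pm1},\dots,\sigma_{k-1}^{\pm1}$); here $k$, the indices and the element $x\in\mathcal{M}_{0,k}$ are uniquely determined, and writing $x$ in the Gillette–Van Buskirk (Markov-type) normal form of $\mathcal{M}_{0,k}$ gives a unique normal form word.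
   Context: Let $S^2$ be the 2-sphere with marked points $Q_n=\{q_1,\dots,q_n\}$. For a partial bijection $t:I\to J$ with $I,J\subseteq\{1,\dots,n\}$, consider orientation-preserving homeomorphisms $h$ of $S^2$ with $h(q_i)=q_{t(i)}$ for $i\in I$ (no condition on other marked points); two such with the same $t$ are identified if isotopic through homeomorphisms with this property. The set $\mathcal{IM}_{0,n}$ of all such classes is a monoid under composition (products written left to right), the underlying partial bijection of a composite being the composite partial bijection. $\sigma_i$ ($1\le i\le n-1$) is the class of the half-twist interchanging $q_i$ and $q_{i+1}$; $\epsilon_i$ is the class of the identity with underlying partial bijection the identity of $\{1,\dots,n\}\setminus\{i\}$; $\epsilon_{k+1,n}=\epsilon_{k+1}\epsilon_{k+2}\cdots\epsilon_n$ is the class of the identity with underlying partial bijection the identity of $\{1,\dots,k\}$ ($\epsilon_{n+1,n}=1$). $\mathcal{M}_{0,k}$ is the mapping class group of the sphere with $k$ marked points, generated by $\sigma_1,\dots,\sigma_{k-1}$. *)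

(* Defs.v *)
From Stdlib Require Import Reals Lra List ZArith.
Open Scope R_scope.

Definition pt : Type := (R * R * R)%type.
Definition S2 (p : pt) : Prop :=
  let '(x, y, z) := p in x * x + y * y + z * z = 1.
Definition dist3 (p q : pt) : R :=
  let '(x, y, z) := p in let '(x', y', z') := q in
  sqrt ((x - x') * (x - x') + (y - y') * (y - y') + (z - z') * (z - z')).

Definition Npole : pt := (0, 0, 1).
Definition stereo (p : pt) : R * R :=
  let '(x, y, z) := p in (x / (1 - z), y / (1 - z)).
Definition inv_stereo (w : R * R) : pt :=
  let '(u, v) := w in
  let d := 1 + u * u + v * v in
  (2 * u / d, 2 * v / d, (u * u + v * v - 1) / d).

Definition q (i : nat) : pt := inv_stereo (INR i, 0).

Definition maps_S2 (f : pt -> pt) : Prop := forall p, S2 p -> S2 (f p).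
Definition cont_S2 (f : pt -> pt) : Prop :=
  forall p, S2 p -> forall eps, 0 < eps -> exists delta, 0 < delta /\
    forall p', S2 p' -> dist3 p p' < delta -> dist3 (f p) (f p') < eps.
Definition homeo (h : pt -> pt) : Prop :=
  maps_S2 h /\ cont_S2 h /\
  exists g : pt -> pt, maps_S2 g /\ cont_S2 g /\
    (forall p, S2 p -> g (h p) = p) /\ (forall p, S2 p -> h (g p) = p).

Definition in01 (s : R) : Prop := 0 <= s <= 1.
Definition cont01 (th : R -> R) : Prop :=
  forall s, in01 s -> forall eps, 0 < eps -> exists delta, 0 < delta /\
    forall s', in01 s' -> Rabs (s - s') < delta -> Rabs (th s - th s') < eps.
Definition winds (gamma : R -> R * R) (c : R * R) (m : Z) : Prop :=
  exists th : R -> R, cont01 th /\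
    (forall s, in01 s ->
       let '(gx, gy) := gamma s in let '(cx, cy) := c in
       let rho := sqrt ((gx - cx) * (gx - cx) + (gy - cy) * (gy - cy)) in
       0 < rho /\ gx - cx = rho * cos (th s) /\ gy - cy = rho * sin (th s)) /\
    th 1 - th 0 = 2 * PI * IZR m.
(* orientation-preserving: in the stereographic chart, every small positively
   oriented circle around p is mapped to a loop of winding number +1 around h p *)
Definition orient_pres (h : pt -> pt) : Prop :=
  forall p, S2 p -> p <> Npole -> h p <> Npole ->
    exists r0, 0 < r0 /\ forall r, 0 < r < r0 ->
      winds (fun s => let '(u, v) := stereo p in
               stereo (h (inv_stereo (u + r * cos (2 * PI * s),
                                      v + r * sin (2 * PI * s)))))
            (stereo (h p)) 1%Z.

(* pb: underlying partial bijection on {1..n} (None = undefined);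
   hm: the homeomorphism *)
Record IMrep : Type := mkIM { pb : nat -> option nat; hm : pt -> pt }.

Definition pbij (n : nat) (t : nat -> option nat) : Prop :=
  (forall i j, t i = Some j -> (1 <= i <= n)%nat /\ (1 <= j <= n)%nat) /\
  (forall i i' j, t i = Some j -> t i' = Some j -> i = i').

Definition respects (t : nat -> option nat) (h : pt -> pt) : Prop :=
  forall i j, t i = Some j -> h (q i) = q j.

Definition validIM (n : nat) (e : IMrep) : Prop :=
  pbij n (pb e) /\ homeo (hm e) /\ orient_pres (hm e) /\ respects (pb e) (hm e).

Definition equivIM (e1 e2 : IMrep) : Prop :=
  (forall i, pb e1 i = pb e2 i) /\
  exists H : R -> pt -> pt,
    (forall s p, in01 s -> S2 p -> forall eps, 0 < eps -> exists delta, 0 < delta /\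
       forall s' p', in01 s' -> S2 p' -> Rabs (s - s') < delta -> dist3 p p' < delta ->
         dist3 (H s p) (H s' p') < eps) /\
    (forall s, in01 s -> homeo (H s) /\ respects (pb e1) (H s)) /\
    (forall p, S2 p -> H 0 p = hm e1 p) /\
    (forall p, S2 p -> H 1 p = hm e2 p).

(* product written left to right: first e1, then e2 *)
Definition mulIM (e1 e2 : IMrep) : IMrep :=
  mkIM (fun i => match pb e1 i with Some j => pb e2 j | None => None end)
       (fun p => hm e2 (hm e1 p)).

Definition between (a b i : nat) : bool := Nat.leb a i && Nat.leb i b.

Definition oneIM (n : nat) : IMrep :=
  mkIM (fun i => if between 1 n i then Some i else None) (fun p => p).

Definition prodIM (n : nat) (l : list IMrep) : IMrep := fold_left mulIM l (oneIM n).

(* epsilon_{k+1,n}: identity homeomorphism, partial bijection id of {1..k} *)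
Definition eps_from (k : nat) : IMrep :=
  mkIM (fun i => if between 1 k i then Some i else None) (fun p => p).

(* in the plane chart the marked points are (1,0),...,(n,0); sigma_i rotates the
   disc of radius 3/5 about (i+1/2, 0) by angle pi (counterclockwise),
   interpolating to the identity in the annulus 3/5 <= r <= 7/10 *)
Definition rot (a : R) (w : R * R) : R * R :=
  let '(x, y) := w in (x * cos a - y * sin a, x * sin a + y * cos a).
Definition twist_profile (r : R) : R :=
  if Rle_dec r (3 / 5) then 1
  else if Rle_dec r (7 / 10) then (7 / 10 - r) * 10 else 0.
Definition tw_plane (i : nat) (w : R * R) : R * R :=
  let cx := INR i + / 2 in
  let '(x, y) := w in
  let dx := x - cx in
  let r := sqrt (dx * dx + y * y) in
  let '(a, b) := rot (PI * twist_profile r) (dx, y) in (cx + a, b).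
Definition half_twist (i : nat) (p : pt) : pt :=
  let '(x, y, z) := p in
  if Req_dec_T z 1 then Npole else inv_stereo (tw_plane i (stereo p)).

Definition sigma (n i : nat) : IMrep :=
  mkIM (fun j => if between 1 n j then
                   Some (if Nat.eqb j i then S i else if Nat.eqb j (S i) then i else j)
                 else None)
       (half_twist i).

Definition desc_block (n r m : nat) : list IMrep :=
  map (sigma n) (rev (seq r (S m - r))).
Definition asc_block (n r m : nat) : list IMrep :=
  map (sigma n) (seq r (S m - r)).

(* elements of M_{0,k}: homeomorphisms permuting q_1..q_k (other points free) *)
Definition validM (k : nat) (x : IMrep) : Prop :=
  validIM k x /\ forall i, (1 <= i <= k)%nat -> exists j, pb x i = Some j.

Definition normal_form (n k : nat) (i j : nat -> nat) (x : IMrep) : IMrep :=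
  prodIM n
    (flat_map (fun r => desc_block n r (i r)) (seq 1 k) ++
     (eps_from k :: x :: eps_from k :: nil) ++
     flat_map (fun r => asc_block n r (j r)) (rev (seq 1 k))).

Definition nf_data (n k : nat) (i j : nat -> nat) (x : IMrep) : Prop :=
  (k <= n)%nat /\
  (forall r, (1 <= r < k)%nat -> (i r < i (S r))%nat /\ (j r < j (S r))%nat) /\
  (forall r, (1 <= r <= k)%nat -> (i r <= n - 1)%nat /\ (j r <= n - 1)%nat) /\
  validM k x.

(* Main.v *)
(** If [t] is the partial bijection of [e], the indices are forced: the descending blocks carry
    [q (i_r + 1)] to [q r] and the ascending blocks carry [q r] to [q (j_r + 1)], so the [i_r + 1]
    enumerate the domain of [t] and the [j_r + 1] its range.  With [A] and [B] the products of the
    two families of half-twists, [x] is [B^-1 o h o A^-1] for the homeomorphism [h] of [e], and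
    conjugating isotopies in the same way gives its uniqueness.  The delicate point is that [x] still
    preserves orientation in the sense of winding numbers of small circles: each twist is joined to
    the identity by an isotopy, and winding numbers are homotopy invariant. *)

From Coquelicot Require Import Coquelicot.
From Stdlib Require Import Reals List ZArith Lra Lia Psatz.
Require Import Defs.

(** That orientation-preserving homeomorphisms are closed under composition and inversion is never
    proved in general; that would be a degree argument. It suffices to compose with one twist at a
    time, on either side. The price is paid in the chart: winding numbers are read in the
    stereographic plane, so during a whole isotopy the image loop must miss the north pole, and this
    is what bounds the radii of the admissible circles. A half-twist is not an involution, so
    reversing a word in the [sigma] inverts its permutation but not its homeomorphism. Twists
    through an arbitrary angle [a] settle both matters: [a = - PI] gives inverses, and scaling [a]
    by [t] gives the isotopies. For existence no isotopy has to be built, because the normal form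
    has the same homeomorphism as the given element at every point of the sphere; isotopies between
    representatives matter only for the uniqueness of [x]. *)

Section ContinuityRules.
Context {U : UniformSpace}.
Implicit Types (f g : U -> R) (x : U).

Lemma continuous_Rplus f g x :
  continuous f x -> continuous g x -> continuous (fun y => f y + g y) x.
Proof. exact (continuous_plus f g x). Qed.

Lemma continuous_Rminus f g x :
  continuous f x -> continuous g x -> continuous (fun y => f y - g y) x.
Proof. exact (continuous_minus f g x). Qed.

Lemma continuous_Rmult f g x :
  continuous f x -> continuous g x -> continuous (fun y => f y * g y) x.
Proof. exact (continuous_mult f g x). Qed.

Lemma continuous_Rdiv f g x :
  continuous f x -> continuous g x -> g x <> 0 -> continuous (fun y => f y / g y) x.
Proof.
  intros Hf Hg Hx. apply continuous_Rmult; [exact Hf|].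
  apply (continuous_comp g Rinv); [exact Hg|]. now apply continuous_Rinv.
Qed.

Lemma continuous_pair {V W : UniformSpace} (f : U -> V) (g : U -> W) x :
  continuous f x -> continuous g x -> continuous (fun y => (f y, g y)) x.
Proof.
  intros Hf Hg P [eps HP].
  assert (H1 := Hf _ (locally_ball (f x) eps)).
  assert (H2 := Hg _ (locally_ball (g x) eps)).
  unfold filtermap in *.
  generalize (filter_and _ _ H1 H2). apply filter_imp.
  intros y [A B]. apply HP. split; assumption.
Qed.

Lemma continuous_fst_comp {V W : UniformSpace} (f : U -> V * W) x :
  continuous f x -> continuous (fun y => fst (f y)) x.
Proof.
  intros Hf. apply (continuous_comp f fst); [exact Hf|].
  destruct (f x); apply continuous_fst.
Qed.

Lemma continuous_snd_comp {V W : UniformSpace} (f : U -> V * W) x :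
  continuous f x -> continuous (fun y => snd (f y)) x.
Proof.
  intros Hf. apply (continuous_comp f snd); [exact Hf|].
  destruct (f x); apply continuous_snd.
Qed.

End ContinuityRules.

(** Follows the syntax of the function; what it leaves open is the nonvanishing of denominators and
    any head symbol without a rule. *)
Ltac ctn :=
  try assumption; lazymatch goal with
  | |- continuous (fun y => y) _ => apply continuous_id
  | |- continuous (fun _ => ?c) _ => apply continuous_const
  | |- continuous fst _ => apply (continuous_fst_comp (fun z => z)), continuous_id
  | |- continuous snd _ => apply (continuous_snd_comp (fun z => z)), continuous_id
  | |- continuous (fun y => (_, _)) _ => apply continuous_pair; ctn
  | |- continuous (fun y => fst _) _ => apply continuous_fst_comp; ctn
  | |- continuous (fun y => snd _) _ => apply continuous_snd_comp; ctn
  | |- continuous (fun y => _ + _) _ => apply continuous_Rplus; ctn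
  | |- continuous (fun y => _ - _) _ => apply continuous_Rminus; ctn
  | |- continuous (fun y => _ * _) _ => apply continuous_Rmult; ctn
  | |- continuous (fun y => _ / _) _ => apply continuous_Rdiv; [ctn | ctn |]
  | |- continuous (fun y => cos (@?f y)) _ => apply (continuous_comp f cos); [ctn | apply continuous_cos]
  | |- continuous (fun y => sin (@?f y)) _ => apply (continuous_comp f sin); [ctn | apply continuous_sin]
  | |- continuous (fun y => sqrt (@?f y)) _ => apply (continuous_comp f sqrt); [ctn | apply continuous_sqrt]
  | |- continuous (fun y => Rabs (@?f y)) _ => apply (continuous_comp f Rabs); [ctn | apply continuous_Rabs]
  | |- continuous (fun y => atan (@?f y)) _ =>
      apply (continuous_comp f atan); [ctn | apply continuity_pt_filterlim, derivable_continuous_pt, derivable_pt_atan]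
  | _ => idtac
  end.

Lemma continuous_eps (f : R -> R) x :
  continuous f x -> forall eps, 0 < eps -> exists delta, 0 < delta /\
    forall y, Rabs (x - y) < delta -> Rabs (f x - f y) < eps.
Proof.
  intros Hf eps He.
  destruct (Hf _ (locally_ball (f x) (mkposreal eps He))) as [d Hd].
  exists d. split; [apply cond_pos|]. intros y Hy.
  rewrite Rabs_minus_sym. apply Hd. unfold ball; simpl. unfold AbsRing_ball, abs, minus, plus, opp; simpl.
  rewrite Rabs_minus_sym in Hy. exact Hy.
Qed.

Lemma cont01_plus_continuous (th a : R -> R) :
  cont01 th -> (forall s, in01 s -> continuous a s) -> cont01 (fun s => th s + a s).
Proof.
  intros Ht Ha s Hs eps He.
  destruct (Ht s Hs (eps / 2) ltac:(lra)) as (d1 & D1 & E1).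
  destruct (continuous_eps a s (Ha s Hs) (eps / 2) ltac:(lra)) as (d2 & D2 & E2).
  exists (Rmin d1 d2). split; [now apply Rmin_pos|]. intros s' Hs' Hd.
  specialize (E1 s' Hs' (Rlt_le_trans _ _ _ Hd (Rmin_l _ _))).
  specialize (E2 s' (Rlt_le_trans _ _ _ Hd (Rmin_r _ _))).
  replace (th s + a s - (th s' + a s')) with ((th s - th s') + (a s - a s')) by ring.
  eapply Rle_lt_trans; [apply Rabs_triang|]. lra.
Qed.

(** * Continuous angle functions and homotopy invariance of winding numbers *)

Definition angle_lift (f g : R -> R) (delta : R) : Prop :=
  exists th, cont01 th /\
    (forall s, in01 s -> f s = cos (th s) /\ g s = sin (th s)) /\ th 1 - th 0 = delta.

(* The angle from one loop to the other is [atan (cross / dot)]. *)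
Lemma angle_lift_close (f1 g1 f2 g2 : R -> R) delta :
  (forall s, in01 s -> continuous f1 s /\ continuous g1 s /\ continuous f2 s /\ continuous g2 s) ->
  (forall s, in01 s -> f2 s * f2 s + g2 s * g2 s = 1) ->
  (forall s, in01 s -> 0 < f1 s * f2 s + g1 s * g2 s) ->
  f1 0 = f1 1 -> g1 0 = g1 1 -> f2 0 = f2 1 -> g2 0 = g2 1 ->
  angle_lift f1 g1 delta -> angle_lift f2 g2 delta.
Proof.
  intros Hc H2 Hd Ef1 Eg1 Ef2 Eg2 (th & Ct & Ht & Et).
  pose (dot := fun s => f1 s * f2 s + g1 s * g2 s).
  pose (crs := fun s => f1 s * g2 s - g1 s * f2 s).
  exists (fun s => th s + atan (crs s / dot s)). split; [|split].
  - apply cont01_plus_continuous; [exact Ct|]. intros s Hs.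
    destruct (Hc s Hs) as (? & ? & ? & ?). unfold dot, crs. ctn.
    specialize (Hd s Hs). lra.
  - intros s Hs. specialize (Hd s Hs). specialize (H2 s Hs). destruct (Ht s Hs) as [A B].
    assert (H1 : f1 s * f1 s + g1 s * g1 s = 1).
    { rewrite A, B. generalize (sin2_cos2 (th s)). unfold Rsqr. lra. }
    assert (Hdot : 0 < dot s) by exact Hd.
    (* Lagrange's identity: [dot] and [crs] are the cosine and sine of the angle between the two
       unit vectors. As [dot] is positive, [atan] recovers that angle. *)
    assert (Hn : dot s * dot s + crs s * crs s = 1).
    { unfold dot, crs.
      replace 1 with ((f1 s * f1 s + g1 s * g1 s) * (f2 s * f2 s + g2 s * g2 s)) by (rewrite H1, H2; ring).
      ring. }
    assert (Hq : sqrt (1 + (crs s / dot s)²) = / dot s).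
    { replace (1 + (crs s / dot s)²) with (/ dot s * / dot s).
      - apply sqrt_square. left. now apply Rinv_0_lt_compat.
      - unfold Rsqr. replace (/ dot s * / dot s) with ((dot s * dot s + crs s * crs s) * (/ dot s * / dot s)) by (rewrite Hn; ring).
        field. lra. }
    rewrite cos_plus, sin_plus, cos_atan, sin_atan, Hq, <- A, <- B.
    replace (1 / / dot s) with (dot s) by (field; lra).
    replace (crs s / dot s / / dot s) with (crs s) by (field; lra).
    unfold dot, crs. split.
    + transitivity (f2 s * (f1 s * f1 s + g1 s * g1 s)); [rewrite H1; ring | ring].
    + transitivity (g2 s * (f1 s * f1 s + g1 s * g1 s)); [rewrite H1; ring | ring].
  (* Both loops are closed, so the correction is the same at 0 and at 1 and cancels in the total
     angle. *)
  - unfold dot, crs. rewrite <- Ef1, <- Eg1, <- Ef2, <- Eg2. lra.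
Qed.

(** By uniform continuity on the unit square, the homotopy can be cut into [N] stages so short that
    consecutive loops satisfy [angle_lift_close]; the total angle then passes from stage to
    stage. *)
Lemma angle_lift_homotopy (F G : R -> R -> R) delta :
  (forall t s, in01 t -> in01 s ->
     continuous (fun z : R * R => F (fst z) (snd z)) (t, s) /\
     continuous (fun z : R * R => G (fst z) (snd z)) (t, s) /\
     F t s * F t s + G t s * G t s = 1) ->
  (forall t, in01 t -> F t 0 = F t 1 /\ G t 0 = G t 1) ->
  angle_lift (F 0) (G 0) delta -> angle_lift (F 1) (G 1) delta.
Proof.
  intros Hc Hl H0.
  assert (HcF : forall x y, 0 <= x <= 1 -> 0 <= y <= 1 -> continuity_2d_pt F x y).
  { intros x y Hx Hy. apply continuity_2d_pt_filterlim. exact (proj1 (Hc x y Hx Hy)). }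
  assert (HcG : forall x y, 0 <= x <= 1 -> 0 <= y <= 1 -> continuity_2d_pt G x y).
  { intros x y Hx Hy. apply continuity_2d_pt_filterlim. exact (proj1 (proj2 (Hc x y Hx Hy))). }
  assert (Hs1 : forall (K : R -> R -> R) t s, continuous (fun z : R * R => K (fst z) (snd z)) (t, s) ->
                  continuous (K t) s).
  { intros K t s HK. apply (continuous_comp (fun s => (t, s)) (fun z => K (fst z) (snd z))); [ctn | exact HK]. }
  (* If each coordinate moves by less than 1/2, the squared chord between the unit vectors is at
     most 1/2, so their scalar product, 1 minus half of it, is at least 3/4. *)
  pose (half := mkposreal (/ 2) ltac:(lra)).
  destruct (uniform_continuity_2d F 0 1 0 1 HcF half) as [d1 D1].
  destruct (uniform_continuity_2d G 0 1 0 1 HcG half) as [d2 D2].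
  assert (Hd : 0 < Rmin d1 d2) by (apply Rmin_pos; apply cond_pos).
  destruct (archimed_cor1 _ Hd) as (N & HN & HN0).
  assert (HNR : 0 < INR N) by (apply lt_0_INR; lia).
  assert (Hk : forall k, (k <= N)%nat -> in01 (INR k / INR N)).
  { intros k Hk. apply le_INR in Hk. generalize (pos_INR k). intros Hk0. split.
    - apply Rmult_le_pos; [lra | left; now apply Rinv_0_lt_compat].
    - apply (Rmult_le_reg_r (INR N)); [lra|]. unfold Rdiv. rewrite Rmult_assoc, Rinv_l; lra. }
  assert (Hind : forall k, (k <= N)%nat -> angle_lift (F (INR k / INR N)) (G (INR k / INR N)) delta).
  { induction k as [|k IH]; intros Hle.
    - simpl INR. replace (0 / INR N) with 0 by (field; lra). exact H0.
    - specialize (IH ltac:(lia)).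
      assert (Ha := Hk k ltac:(lia)). assert (Hb := Hk (S k) Hle).
      assert (Hab : Rabs (INR (S k) / INR N - INR k / INR N) < Rmin d1 d2).
      { rewrite S_INR. replace ((INR k + 1) / INR N - INR k / INR N) with (/ INR N) by (field; lra).
        rewrite Rabs_right; [exact HN|]. left. now apply Rinv_0_lt_compat. }
      remember (INR k / INR N) as a. remember (INR (S k) / INR N) as b.
      destruct (Hl a Ha) as [La1 La2]. destruct (Hl b Hb) as [Lb1 Lb2].
      revert IH. apply angle_lift_close; try assumption.
      + intros s Hs. destruct (Hc a s Ha Hs) as (C1 & C2 & _). destruct (Hc b s Hb Hs) as (C3 & C4 & _).
        auto.
      + intros s Hs. apply (Hc b s Hb Hs).
      + intros s Hs. destruct (Hc a s Ha Hs) as (_ & _ & Na). destruct (Hc b s Hb Hs) as (_ & _ & Nb).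
        assert (E1 : Rabs (F b s - F a s) < / 2).
        { apply (D1 a s b s); try assumption.
          - eapply Rlt_le_trans; [exact Hab | apply Rmin_l].
          - rewrite Rminus_diag, Rabs_R0. apply cond_pos. }
        assert (E2 : Rabs (G b s - G a s) < / 2).
        { apply (D2 a s b s); try assumption.
          - eapply Rlt_le_trans; [exact Hab | apply Rmin_r].
          - rewrite Rminus_diag, Rabs_R0. apply cond_pos. }
        apply Rabs_def2 in E1. apply Rabs_def2 in E2.
        assert (Q1 : (F b s - F a s) * (F b s - F a s) <= / 4) by nra.
        assert (Q2 : (G b s - G a s) * (G b s - G a s) <= / 4) by nra.
        nra. }
  specialize (Hind N (Nat.le_refl _)).
  replace (INR N / INR N) with 1 in Hind by (field; lra). exact Hind.
Qed.

(** The centre may move along with the loop: only the direction of [G t s - c t] matters, and it is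
    defined because the loop never meets the centre. *)
Lemma winds_homotopy (G : R -> R -> R * R) (c : R -> R * R) (m : Z) :
  (forall t s, in01 t -> in01 s -> continuous (fun z : R * R => G (fst z) (snd z)) (t, s)) ->
  (forall t, in01 t -> continuous c t) ->
  (forall t s, in01 t -> in01 s -> G t s <> c t) ->
  (forall t, in01 t -> G t 0 = G t 1) ->
  winds (G 0) (c 0) m -> winds (G 1) (c 1) m.
Proof.
  intros HG Hcc Hne Hl.
  pose (X := fun t s => fst (G t s) - fst (c t)).
  pose (Y := fun t s => snd (G t s) - snd (c t)).
  pose (N := fun t s => sqrt (X t s * X t s + Y t s * Y t s)).
  assert (HN : forall t s, in01 t -> in01 s -> 0 < N t s).
  { intros t s Ht Hs. apply sqrt_lt_R0.
    assert (X t s <> 0 \/ Y t s <> 0) as [H|H].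
    { destruct (Req_dec (X t s) 0) as [H1|H1]; [|now left].
      destruct (Req_dec (Y t s) 0) as [H2|H2]; [|now right].
      exfalso. apply (Hne t s Ht Hs). rewrite (surjective_pairing (G t s)), (surjective_pairing (c t)).
      unfold X, Y in *. f_equal; lra. }
    all: nra. }
  assert (Hin : in01 0 /\ in01 1) by (unfold in01; lra). destruct Hin as [I0 I1].
  assert (Hw : forall t, in01 t -> winds (G t) (c t) m <->
                  angle_lift (fun s => X t s / N t s) (fun s => Y t s / N t s) (2 * PI * IZR m)).
  { intros t It. unfold winds, angle_lift. split.
    - intros (th & C & E & D). exists th. split; [exact C|]. split; [|exact D].
      intros s Hs. specialize (E s Hs). specialize (HN t s It Hs). unfold N in HN, E |- *; unfold X, Y in HN, E |- *.
      destruct (G t s) as [gx gy], (c t) as [cx cy]. simpl in *. destruct E as (_ & E1 & E2).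
      remember (sqrt _) as r in HN, E1, E2 |- *. rewrite E1, E2. split; field; lra.
    - intros (th & C & E & D). exists th. split; [exact C|]. split; [|exact D].
      intros s Hs. specialize (E s Hs). specialize (HN t s It Hs). unfold N in HN, E |- *; unfold X, Y in HN, E |- *.
      destruct (G t s) as [gx gy], (c t) as [cx cy]. simpl in *. destruct E as (E1 & E2).
      remember (sqrt _) as r in HN, E1, E2 |- *. rewrite <- E1, <- E2. split; [exact HN|]. split; field; lra. }
  rewrite (Hw 0 I0), (Hw 1 I1).
  apply (angle_lift_homotopy (fun t s => X t s / N t s) (fun t s => Y t s / N t s)).
  - intros t s Ht Hs. specialize (HN t s Ht Hs).
    assert (C1 := HG t s Ht Hs).
    assert (C2 : continuous (fun z : R * R => c (fst z)) (t, s)).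
    { apply (continuous_comp fst c); [apply continuous_fst | now apply Hcc]. }
    repeat split.
    + unfold X, Y, N, X, Y in *. ctn. apply Rgt_not_eq. exact HN.
    + unfold X, Y, N, X, Y in *. ctn. apply Rgt_not_eq. exact HN.
    + assert (E : N t s * N t s = X t s * X t s + Y t s * Y t s).
      { apply sqrt_sqrt. nra. }
      transitivity ((X t s * X t s + Y t s * Y t s) / (N t s * N t s)); [field; lra|].
      rewrite E. field. rewrite <- E. nra.
  - intros t Ht. unfold N, X, Y. now rewrite (Hl t Ht).
Qed.

(** * Twists of the sphere *)

Lemma winds_ext (g1 g2 : R -> R * R) (c1 c2 : R * R) (m : Z) :
  (forall s, in01 s -> g1 s = g2 s) -> c1 = c2 -> winds g1 c1 m -> winds g2 c2 m.
Proof.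
  intros Hg <- (th & C & E & D). exists th. split; [exact C|]. split; [|exact D].
  intros s Hs. rewrite <- (Hg s Hs). exact (E s Hs).
Qed.

(** The chart maps written with projections, a form that [ctn] can traverse. *)
Lemma stereoE p : stereo p = (fst (fst p) / (1 - snd p), snd (fst p) / (1 - snd p)).
Proof. now destruct p as [[x y] z]. Qed.

Lemma inv_stereoE w :
  inv_stereo w =
    (2 * fst w / (1 + fst w * fst w + snd w * snd w),
     2 * snd w / (1 + fst w * fst w + snd w * snd w),
     (fst w * fst w + snd w * snd w - 1) / (1 + fst w * fst w + snd w * snd w)).
Proof. now destruct w. Qed.

Lemma S2_inv_stereo w : S2 (inv_stereo w).
Proof. destruct w as [u v]. simpl. field. nra. Qed.

Lemma inv_stereo_neq_Npole w : inv_stereo w <> Npole.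
Proof.
  destruct w as [u v]. unfold Npole. simpl. intros H. injection H as _ _ H.
  assert (E : (u * u + v * v - 1) = 1 * (1 + u * u + v * v)).
  { transitivity ((u * u + v * v - 1) / (1 + u * u + v * v) * (1 + u * u + v * v)); [field; nra|].
    now rewrite H. }
  nra.
Qed.

Lemma stereo_inv_stereo w : stereo (inv_stereo w) = w.
Proof.
  destruct w as [u v]. simpl.
  replace (1 - (u * u + v * v - 1) / (1 + u * u + v * v)) with (2 / (1 + u * u + v * v)) by (field; nra).
  f_equal; field; nra.
Qed.

Lemma S2_height_neq1 p : S2 p -> p <> Npole -> snd p <> 1.
Proof.
  destruct p as [[x y] z]. simpl. intros H Hn ->. apply Hn. unfold Npole.
  assert (x = 0) by nra. assert (y = 0) by nra. now subst.
Qed.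

Lemma inv_stereo_stereo p : S2 p -> p <> Npole -> inv_stereo (stereo p) = p.
Proof.
  intros H Hn. generalize (S2_height_neq1 p H Hn). destruct p as [[x y] z]. simpl in *. intros Hz.
  assert (E : 1 + x / (1 - z) * (x / (1 - z)) + y / (1 - z) * (y / (1 - z)) = 2 / (1 - z)).
  { transitivity ((x * x + y * y + z * z - 2 * z + 1) / ((1 - z) * (1 - z))); [field; lra|].
    rewrite H. field. lra. }
  assert (E' : x / (1 - z) * (x / (1 - z)) + y / (1 - z) * (y / (1 - z)) - 1 = 2 / (1 - z) - 2)
    by (rewrite <- E; ring).
  rewrite E, E'. f_equal; [f_equal|]; field; lra.
Qed.

Lemma inv_stereo_inj w w' : inv_stereo w = inv_stereo w' -> w = w'.
Proof. intros H. now rewrite <- (stereo_inv_stereo w), H, stereo_inv_stereo. Qed.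

Lemma stereo_inj p p' : S2 p -> p <> Npole -> S2 p' -> p' <> Npole -> stereo p = stereo p' -> p = p'.
Proof.
  intros H1 H2 H3 H4 H. now rewrite <- (inv_stereo_stereo p), H, inv_stereo_stereo.
Qed.

Lemma S2_Npole : S2 Npole.
Proof. simpl. ring. Qed.

Lemma pt_eq_dec (p p' : pt) : {p = p'} + {p <> p'}.
Proof. repeat decide equality; apply Req_dec_T. Qed.

Lemma dist3_coord p p' :
  Rabs (fst (fst p) - fst (fst p')) <= dist3 p p' /\
  Rabs (snd (fst p) - snd (fst p')) <= dist3 p p' /\
  Rabs (snd p - snd p') <= dist3 p p'.
Proof.
  destruct p as [[x y] z], p' as [[x' y'] z']. simpl.
  assert (Hx : forall u, 0 <= u * u) by (intros; nra).
  generalize (Hx (x - x')) (Hx (y - y')) (Hx (z - z')). intros A B C.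
  repeat split; rewrite <- sqrt_Rsqr_abs; apply sqrt_le_1_alt; unfold Rsqr; lra.
Qed.

(** With [dist3_coord], this compares Euclidean balls with the boxes that are the balls of the
    product uniform structure; the factor 3 is a crude replacement for the square root of 3. *)
Lemma dist3_lt p p' e :
  Rabs (fst (fst p) - fst (fst p')) < e / 3 ->
  Rabs (snd (fst p) - snd (fst p')) < e / 3 ->
  Rabs (snd p - snd p') < e / 3 -> dist3 p p' < e.
Proof.
  destruct p as [[x y] z], p' as [[x' y'] z']. simpl. intros A B C.
  apply Rabs_def2 in A, B, C.
  assert (He : 0 < e) by lra.
  rewrite <- (sqrt_square e) by lra. apply sqrt_lt_1_alt.
  generalize (Rle_0_sqr (x - x')) (Rle_0_sqr (y - y')) (Rle_0_sqr (z - z')). unfold Rsqr. intros.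
  split; [lra|].
  assert (forall u, u < e / 3 -> - (e / 3) < u -> u * u < (e / 3) * (e / 3)) by (intros; nra).
  assert (X := H2 _ (proj1 A) (proj2 A)). assert (Y := H2 _ (proj1 B) (proj2 B)).
  assert (Z := H2 _ (proj1 C) (proj2 C)). nra.
Qed.

(** [cont_S2] controls [h] only along the sphere, so [h] itself need not be continuous on the
    ambient space; composed with a map into the sphere it is. *)
Lemma continuous_cont_S2_comp {U : UniformSpace} (h : pt -> pt) (f : U -> R * R * R) x :
  cont_S2 h -> (forall u, S2 (f u)) -> continuous f x ->
  continuous (fun u => h (f u) : R * R * R) x.
Proof.
  intros Hh HS Hf P [eps HP].
  destruct (Hh (f x) (HS x) eps (cond_pos eps)) as (d & Hd & E).
  assert (Hd3 : 0 < d / 3) by lra.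
  generalize (Hf _ (locally_ball (f x) (mkposreal _ Hd3))). unfold filtermap.
  apply filter_imp. intros u [[B1 B2] B3]. apply HP.
  assert (L : dist3 (f x) (f u) < d).
  { unfold ball in B1, B2, B3; simpl in B1, B2, B3.
    unfold AbsRing_ball, abs, minus, plus, opp in B1, B2, B3; simpl in B1, B2, B3.
    apply dist3_lt; rewrite Rabs_minus_sym; assumption. }
  specialize (E (f u) (HS u) L).
  destruct (dist3_coord (h (f x)) (h (f u))) as (C1 & C2 & C3).
  rewrite Rabs_minus_sym in C1, C2, C3.
  repeat split; (eapply Rle_lt_trans; [|exact E]); assumption.
Qed.

Lemma continuous_dist3 (f : pt -> pt) (p : R * R * R) :
  continuous (f : R * R * R -> R * R * R) p -> forall eps, 0 < eps -> exists delta, 0 < delta /\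
    forall p', dist3 p p' < delta -> dist3 (f p) (f p') < eps.
Proof.
  intros Hf eps He. assert (He3 : 0 < eps / 3) by lra.
  destruct (Hf _ (locally_ball (f p) (mkposreal _ He3))) as [d Hd].
  exists d. split; [apply cond_pos|]. intros p' Hp.
  destruct (dist3_coord p p') as (C1 & C2 & C3).
  rewrite Rabs_minus_sym in C1, C2, C3.
  assert (B : ball p d p').
  { repeat split; (eapply Rle_lt_trans; [|exact Hp]); assumption. }
  destruct (Hd p' B) as [[B1 B2] B3].
  unfold ball in B1, B2, B3; simpl in B1, B2, B3.
  unfold AbsRing_ball, abs, minus, plus, opp in B1, B2, B3; simpl in B1, B2, B3.
  apply dist3_lt; rewrite Rabs_minus_sym; assumption.
Qed.

Lemma continuous_stereo_comp {U : UniformSpace} (f : U -> R * R * R) x :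
  continuous f x -> snd (f x) <> 1 -> continuous (fun u => stereo (f u)) x.
Proof.
  intros Hf Hx. apply (continuous_ext (fun u => (fst (fst (f u)) / (1 - snd (f u)), snd (fst (f u)) / (1 - snd (f u))))).
  { intros u. now rewrite stereoE. }
  ctn; lra.
Qed.

Lemma continuous_inv_stereo_comp {U : UniformSpace} (f : U -> R * R) x :
  continuous f x -> continuous (fun u => inv_stereo (f u) : R * R * R) x.
Proof.
  intros Hf. eapply continuous_ext.
  { intros u. symmetry. apply inv_stereoE. }
  ctn; nra.
Qed.

Lemma homeo_inj h p p' : homeo h -> S2 p -> S2 p' -> h p = h p' -> p = p'.
Proof.
  intros (_ & _ & g & _ & _ & E & _) H1 H2 H. now rewrite <- (E p H1), H, E.
Qed.

Lemma maps_S2_comp f g : maps_S2 f -> maps_S2 g -> maps_S2 (fun p => g (f p)).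
Proof. intros Hf Hg p Hp. auto. Qed.

Lemma cont_S2_comp f g : maps_S2 f -> cont_S2 f -> cont_S2 g -> cont_S2 (fun p => g (f p)).
Proof.
  intros Mf Cf Cg p Hp eps He. destruct (Cg (f p) (Mf p Hp) eps He) as (d & Hd & E).
  destruct (Cf p Hp d Hd) as (d' & Hd' & E'). exists d'. split; [exact Hd'|]. intros; apply E; auto.
Qed.

Lemma homeo_comp f g : homeo f -> homeo g -> homeo (fun p => g (f p)).
Proof.
  intros (Mf & Cf & f' & Mf' & Cf' & L & R0) (Mg & Cg & g' & Mg' & Cg' & L' & R').
  split; [now apply maps_S2_comp|]. split; [now apply cont_S2_comp|].
  exists (fun p => f' (g' p)). split; [now apply maps_S2_comp|]. split; [now apply cont_S2_comp|].
  split; intros p Hp.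
  - rewrite L'; auto.
  - rewrite R0; auto.
Qed.

Lemma sqdist_pos (w c : R * R) :
  w <> c -> 0 < (fst w - fst c) * (fst w - fst c) + (snd w - snd c) * (snd w - snd c).
Proof.
  intros H. destruct w as [a b], c as [a' b']. simpl.
  assert (A := Rle_0_sqr (a - a')). assert (B := Rle_0_sqr (b - b')). unfold Rsqr in A, B.
  destruct (Req_dec a a') as [->|E].
  - destruct (Req_dec b b') as [->|E]; [now destruct H|].
    assert (C := Rsqr_pos_lt (b - b') ltac:(lra)). unfold Rsqr in C. lra.
  - assert (C := Rsqr_pos_lt (a - a') ltac:(lra)). unfold Rsqr in C. lra.
Qed.

Definition circ (c : R * R) (r s : R) : R * R :=
  (fst c + r * cos (2 * PI * s), snd c + r * sin (2 * PI * s)).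

Lemma circ_sqdist c r s :
  (fst (circ c r s) - fst c) * (fst (circ c r s) - fst c) +
  (snd (circ c r s) - snd c) * (snd (circ c r s) - snd c) = r * r.
Proof.
  unfold circ; simpl. generalize (sin2_cos2 (2 * PI * s)). unfold Rsqr. intros H.
  transitivity (r * r * (sin (2 * PI * s) * sin (2 * PI * s) + cos (2 * PI * s) * cos (2 * PI * s))); [ring|].
  rewrite H. ring.
Qed.

Lemma circ_neq_center c r s : 0 < r -> circ c r s <> c.
Proof. intros Hr H. generalize (circ_sqdist c r s). rewrite H. nra. Qed.

Lemma circ_closed c r : circ c r 0 = circ c r 1.
Proof. unfold circ. now rewrite Rmult_0_r, Rmult_1_r, cos_0, sin_0, cos_2PI, sin_2PI. Qed.

(** The points other than the pole are exactly the [inv_stereo c], so the condition can be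
    quantified over the plane. *)
Lemma orient_pres_chart h :
  orient_pres h <->
  forall c, h (inv_stereo c) <> Npole -> exists r0, 0 < r0 /\ forall r, 0 < r < r0 ->
    winds (fun s => stereo (h (inv_stereo (circ c r s)))) (stereo (h (inv_stereo c))) 1%Z.
Proof.
  split.
  - intros H c Hc.
    destruct (H (inv_stereo c) (S2_inv_stereo c) (inv_stereo_neq_Npole c) Hc) as (r0 & Hr0 & Hw).
    exists r0. split; [exact Hr0|]. intros r Hr. specialize (Hw r Hr).
    rewrite stereo_inv_stereo in Hw. destruct c as [u v]. exact Hw.
  - intros H p Hp Hn Hhn. generalize (H (stereo p)). rewrite (inv_stereo_stereo p Hp Hn). intros H'.
    destruct (H' Hhn) as (r0 & Hr0 & Hw). exists r0. split; [exact Hr0|]. intros r Hr. specialize (Hw r Hr).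
    destruct (stereo p) as [u v]. exact Hw.
Qed.

(** By injectivity at most one plane point goes to the pole. Circles about [c] that are smaller than
    its distance from [c] therefore have their images inside the chart. *)
Lemma homeo_pole_preimage h c :
  homeo h -> h (inv_stereo c) <> Npole ->
  exists w0, w0 <> c /\ forall w, h (inv_stereo w) = Npole -> w = w0.
Proof.
  intros (_ & _ & k & Mk & _ & L & R0) Hc.
  destruct (pt_eq_dec (k Npole) Npole) as [E|E].
  (* Here the pole is its own preimage, no plane point reaches it, and any point other than [c] will
     do. *)
  - exists (fst c + 1, snd c). split.
    + destruct c; simpl. intros H. injection H. lra.
    + intros w Hw. exfalso. apply (inv_stereo_neq_Npole w).
      now rewrite <- (L _ (S2_inv_stereo w)), Hw.
  - exists (stereo (k Npole)). split.
    + intros H. apply Hc. rewrite <- H, inv_stereo_stereo; auto using S2_Npole.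
    + intros w Hw. now rewrite <- Hw, L, stereo_inv_stereo by apply S2_inv_stereo.
Qed.

(** The map of [tw_plane] with the angle [PI] replaced by a parameter, which makes it a
    one-parameter group. *)
Definition planar_twist (i : nat) (a : R) (w : R * R) : R * R :=
  let cx := INR i + / 2 in
  let dx := fst w - cx in
  let b := a * twist_profile (sqrt (dx * dx + snd w * snd w)) in
  (cx + (dx * cos b - snd w * sin b), dx * sin b + snd w * cos b).

Definition sphere_twist (i : nat) (a : R) (p : pt) : pt :=
  if Req_dec_T (snd p) 1 then Npole else inv_stereo (planar_twist i a (stereo p)).

Lemma half_twistE i p : half_twist i p = sphere_twist i PI p.
Proof.
  destruct p as [[x y] z]. unfold half_twist, sphere_twist. simpl snd.
  destruct (Req_dec_T z 1); [reflexivity|]. now destruct (stereo (x, y, z)).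
Qed.

Lemma planar_twist_plus i a b w : planar_twist i a (planar_twist i b w) = planar_twist i (a + b) w.
Proof.
  destruct w as [x y]. unfold planar_twist. cbn [fst snd].
  set (cx := INR i + / 2). set (dx := x - cx).
  set (th := b * twist_profile (sqrt (dx * dx + y * y))).
  replace (cx + (dx * cos th - y * sin th) - cx) with (dx * cos th - y * sin th) by ring.
  assert (E : (dx * cos th - y * sin th) * (dx * cos th - y * sin th) +
     (dx * sin th + y * cos th) * (dx * sin th + y * cos th) = dx * dx + y * y).
  { generalize (sin2_cos2 th). unfold Rsqr. intros H.
    transitivity ((dx * dx + y * y) * (sin th * sin th + cos th * cos th)); [ring|].
    rewrite H. ring. }
  rewrite E, (Rmult_plus_distr_r a b). fold th. rewrite cos_plus, sin_plus. f_equal; ring.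
Qed.

Lemma planar_twist_0 i w : planar_twist i 0 w = w.
Proof.
  destruct w as [x y]. unfold planar_twist. cbn [fst snd]. rewrite Rmult_0_l, cos_0, sin_0. f_equal; ring.
Qed.

Lemma planar_twist_inj i a w w' : planar_twist i a w = planar_twist i a w' -> w = w'.
Proof.
  intros H. rewrite <- (planar_twist_0 i w), <- (planar_twist_0 i w').
  replace 0 with (- a + a) by ring. now rewrite <- !planar_twist_plus, H.
Qed.

(** The piecewise linear profile in terms of absolute values, so that its continuity needs no case
    distinction. *)
Lemma twist_profileE r : twist_profile r = (1 + (Rabs (7 - 10 * r) - Rabs (6 - 10 * r))) * / 2.
Proof.
  unfold twist_profile. destruct (Rle_dec r (3 / 5)); [|destruct (Rle_dec r (7 / 10))];
  unfold Rabs; destruct (Rcase_abs (7 - 10 * r)), (Rcase_abs (6 - 10 * r)); lra.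
Qed.

Lemma continuous_planar_twist_comp {U : UniformSpace} i (f : U -> R) (g : U -> R * R) x :
  continuous f x -> continuous g x -> continuous (fun u => planar_twist i (f u) (g u)) x.
Proof.
  intros Hf Hg.
  pose (nrm := fun u => sqrt ((fst (g u) - (INR i + / 2)) * (fst (g u) - (INR i + / 2)) + snd (g u) * snd (g u))).
  assert (Hp : continuous (fun u => f u * twist_profile (nrm u)) x).
  { apply (continuous_ext (fun u => f u * ((1 + (Rabs (7 - 10 * nrm u) - Rabs (6 - 10 * nrm u))) * / 2))).
    { intros u. now rewrite twist_profileE. }
    unfold nrm. ctn. }
  unfold planar_twist. cbv zeta. fold nrm in Hp.
  change (continuous (fun u => (INR i + / 2 + ((fst (g u) - (INR i + / 2)) * cos (f u * twist_profile (nrm u)) - snd (g u) * sin (f u * twist_profile (nrm u))),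
    (fst (g u) - (INR i + / 2)) * sin (f u * twist_profile (nrm u)) + snd (g u) * cos (f u * twist_profile (nrm u)))) x).
  ctn.
Qed.

Lemma planar_twist_far i a w :
  7 / 10 < sqrt ((fst w - (INR i + / 2)) * (fst w - (INR i + / 2)) + snd w * snd w) ->
  planar_twist i a w = w.
Proof.
  intros H. unfold planar_twist. cbv zeta.
  assert (E : twist_profile (sqrt ((fst w - (INR i + / 2)) * (fst w - (INR i + / 2)) + snd w * snd w)) = 0).
  { unfold twist_profile. destruct (Rle_dec _ (3 / 5)); [lra|]. destruct (Rle_dec _ (7 / 10)); lra. }
  rewrite E, Rmult_0_r, cos_0, sin_0. destruct w; simpl. f_equal; ring.
Qed.

Lemma sphere_twist_inv_stereo i a w : sphere_twist i a (inv_stereo w) = inv_stereo (planar_twist i a w).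
Proof.
  unfold sphere_twist. destruct (Req_dec_T _ 1) as [E|E].
  - exfalso. revert E. apply S2_height_neq1; [apply S2_inv_stereo | apply inv_stereo_neq_Npole].
  - now rewrite stereo_inv_stereo.
Qed.

Lemma sphere_twist_Npole i a : sphere_twist i a Npole = Npole.
Proof. unfold sphere_twist. simpl. destruct (Req_dec_T 1 1); [reflexivity | lra]. Qed.

Lemma S2_cases p : S2 p -> p = Npole \/ exists w, p = inv_stereo w.
Proof.
  intros H. destruct (pt_eq_dec p Npole) as [E|E]; [now left|].
  right. exists (stereo p). now rewrite inv_stereo_stereo.
Qed.

Lemma maps_S2_sphere_twist i a : maps_S2 (sphere_twist i a).
Proof.
  intros p Hp. destruct (S2_cases p Hp) as [->|[w ->]].
  - rewrite sphere_twist_Npole. apply S2_Npole.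
  - rewrite sphere_twist_inv_stereo. apply S2_inv_stereo.
Qed.

Lemma sphere_twist_opp i a p : S2 p -> sphere_twist i (- a) (sphere_twist i a p) = p.
Proof.
  intros Hp. destruct (S2_cases p Hp) as [->|[w ->]].
  - now rewrite !sphere_twist_Npole.
  - rewrite !sphere_twist_inv_stereo, planar_twist_plus. now rewrite Rplus_opp_l, planar_twist_0.
Qed.

Lemma sphere_twist_opp' i a p : S2 p -> sphere_twist i a (sphere_twist i (- a) p) = p.
Proof. intros Hp. generalize (sphere_twist_opp i (- a) p Hp). now rewrite Ropp_involutive. Qed.

(* Near the pole the stereographic image leaves the support of the twist. *)
Lemma sphere_twist_near_pole i a :
  exists d, 0 < d /\ forall p, S2 p -> dist3 Npole p < d -> sphere_twist i a p = p.
Proof.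
  (* [M] bounds the squared norm on the support, which lies in the box of half-widths [INR i + 2]
     and 1. A plane point of squared norm [Q] is sent to depth [2 / (1 + Q)] below the pole, so a
     depth under [2 / (M + 1)] forces [Q > M]. *)
  pose (M := (INR i + 2) * (INR i + 2) + 1).
  assert (Hi := pos_INR i).
  assert (HM : 0 < M) by (unfold M; nra).
  exists (2 / (M + 1)). split; [apply Rdiv_lt_0_compat; lra|].
  intros p Hp Hd. destruct (S2_cases p Hp) as [->|[w ->]]; [apply sphere_twist_Npole|].
  rewrite sphere_twist_inv_stereo. f_equal. apply planar_twist_far.
  destruct (dist3_coord Npole (inv_stereo w)) as (_ & _ & C).
  assert (C' := Rle_lt_trans _ _ _ (Rle_trans _ _ _ (Rle_abs _) C) Hd). clear C Hd Hp.
  destruct w as [u v]; simpl in *.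
  replace (1 - (u * u + v * v - 1) / (1 + u * u + v * v)) with (2 / (1 + u * u + v * v)) in C' by (field; nra).
  assert (HQ : M < u * u + v * v).
  { assert (P : 0 < 1 + u * u + v * v) by nra.
    apply (Rmult_lt_compat_r ((1 + u * u + v * v) * (M + 1))) in C'; [|nra].
    replace (2 / (1 + u * u + v * v) * ((1 + u * u + v * v) * (M + 1))) with (2 * (M + 1)) in C' by (field; lra).
    replace (2 / (M + 1) * ((1 + u * u + v * v) * (M + 1))) with (2 * (1 + u * u + v * v)) in C' by (field; lra).
    lra. }
  set (dx := u - (INR i + / 2)).
  destruct (Rlt_le_dec (7 / 10) (sqrt (dx * dx + v * v))) as [H|H]; [exact H|exfalso].
  assert (P0 : 0 <= dx * dx + v * v) by nra.
  assert (P1 : dx * dx + v * v <= 1).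
  { rewrite <- (sqrt_sqrt _ P0). generalize (sqrt_pos (dx * dx + v * v)). nra. }
  assert (P2 : dx <= 1 /\ -1 <= dx) by nra.
  assert (P3 : v * v <= 1) by nra.
  assert (u <= INR i + 2 /\ - (INR i + 2) <= u) by (unfold dx in P2; lra).
  unfold M in HQ. nra.
Qed.

Lemma cont_S2_sphere_twist i a : cont_S2 (sphere_twist i a).
Proof.
  intros p Hp eps He. destruct (pt_eq_dec p Npole) as [->|Hn].
  - destruct (sphere_twist_near_pole i a) as (d & Hd & E).
    exists (Rmin d eps). split; [now apply Rmin_pos|]. intros p' Hp' L.
    rewrite sphere_twist_Npole, (E p' Hp').
    + eapply Rlt_le_trans; [exact L | apply Rmin_r].
    + eapply Rlt_le_trans; [exact L | apply Rmin_l].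
  - assert (Hz := S2_height_neq1 p Hp Hn).
    destruct (continuous_dist3 (fun p => inv_stereo (planar_twist i a (stereo p))) p) with (eps := eps)
      as (d & Hd & E); [|exact He|].
    { apply continuous_inv_stereo_comp, (continuous_planar_twist_comp i (fun _ => a)); [ctn|].
      apply continuous_stereo_comp; [apply continuous_id | exact Hz]. }
    (* Within [gap] of [p] the height is never 1, so nearby points take the same branch of
       [sphere_twist]. *)
    pose (gap := Rabs (1 - snd p)).
    assert (Hg : 0 < gap) by (apply Rabs_pos_lt; lra).
    exists (Rmin d gap). split; [now apply Rmin_pos|]. intros p' Hp' L.
    assert (Hz' : snd p' <> 1).
    { intros E1. destruct (dist3_coord p p') as (_ & _ & C). rewrite E1, Rabs_minus_sym in C. fold gap in C.
      generalize (Rmin_r d gap). lra. }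
    unfold sphere_twist. destruct (Req_dec_T (snd p) 1); [contradiction|].
    destruct (Req_dec_T (snd p') 1); [contradiction|].
    apply E. eapply Rlt_le_trans; [exact L | apply Rmin_l].
Qed.

Lemma homeo_sphere_twist i a : homeo (sphere_twist i a).
Proof.
  split; [apply maps_S2_sphere_twist|]. split; [apply cont_S2_sphere_twist|].
  exists (sphere_twist i (- a)).
  split; [apply maps_S2_sphere_twist|]. split; [apply cont_S2_sphere_twist|].
  split; intros p Hp; [now apply sphere_twist_opp | now apply sphere_twist_opp'].
Qed.

Lemma sphere_twist_neq_Npole i a p : S2 p -> sphere_twist i a p <> Npole <-> p <> Npole.
Proof.
  intros Hp. destruct (S2_cases p Hp) as [->|[w ->]].
  - now rewrite sphere_twist_Npole.
  - rewrite sphere_twist_inv_stereo. split; intros _; apply inv_stereo_neq_Npole.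
Qed.

(* Along the isotopy [t |-> sphere_twist i (t * a)] the image loop never meets the image of the centre. *)
Lemma orient_pres_sphere_twist_post i a h :
  homeo h -> orient_pres h -> orient_pres (fun p => sphere_twist i a (h p)).
Proof.
  intros Hh Ho. apply orient_pres_chart. intros c Hc.
  assert (Mh := proj1 Hh). assert (Ch := proj1 (proj2 Hh)).
  assert (HS := Mh _ (S2_inv_stereo c)).
  apply sphere_twist_neq_Npole in Hc; [|exact HS].
  destruct (proj1 (orient_pres_chart h) Ho c Hc) as (r0 & Hr0 & Hw).
  destruct (homeo_pole_preimage h c Hh Hc) as (w0 & Hw0 & Hpre).
  (* Distance from [c] to the only plane point that [h] may send to the pole. The twists fix the
     pole, so this bound serves for every time of the isotopy. *)
  pose (D := sqrt ((fst w0 - fst c) * (fst w0 - fst c) + (snd w0 - snd c) * (snd w0 - snd c))).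
  assert (HD : 0 < D).
  { now apply sqrt_lt_R0, sqdist_pos. }
  exists (Rmin r0 D). split; [now apply Rmin_pos|]. intros r [Hr Hr'].
  assert (Hrr0 : r < r0) by (eapply Rlt_le_trans; [exact Hr' | apply Rmin_l]).
  assert (HrD : r < D) by (eapply Rlt_le_trans; [exact Hr' | apply Rmin_r]).
  assert (Hav : forall s, h (inv_stereo (circ c r s)) <> Npole).
  { intros s E. apply Hpre in E. generalize (circ_sqdist c r s). rewrite E. intros E2.
    unfold D in HrD. rewrite E2, sqrt_square in HrD; lra. }
  assert (HSs : forall s, S2 (h (inv_stereo (circ c r s)))) by (intros; apply Mh, S2_inv_stereo).
  pose (G := fun t s => planar_twist i (t * a) (stereo (h (inv_stereo (circ c r s))))).
  pose (cc := fun t => planar_twist i (t * a) (stereo (h (inv_stereo c)))).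
  apply (winds_ext (G 1) _ (cc 1)).
  - intros s _. unfold G. rewrite Rmult_1_l.
    now rewrite <- (inv_stereo_stereo (h (inv_stereo (circ c r s)))) at 2 by auto;
      rewrite sphere_twist_inv_stereo, stereo_inv_stereo.
  - unfold cc. rewrite Rmult_1_l.
    now rewrite <- (inv_stereo_stereo (h (inv_stereo c))) at 2 by auto;
      rewrite sphere_twist_inv_stereo, stereo_inv_stereo.
  - apply winds_homotopy.
    + intros t s _ _. unfold G. apply continuous_planar_twist_comp; [ctn|].
      apply continuous_stereo_comp; [|apply S2_height_neq1; [apply HSs | apply Hav]].
      apply continuous_cont_S2_comp; [exact Ch | intros; apply S2_inv_stereo |].
      apply continuous_inv_stereo_comp. unfold circ. ctn.
    + intros t _. unfold cc. apply continuous_planar_twist_comp; ctn.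
    + intros t s _ _ E. apply planar_twist_inj, stereo_inj in E; auto.
      apply homeo_inj in E; auto using S2_inv_stereo.
      apply inv_stereo_inj in E. now apply circ_neq_center in E.
    + intros t _. unfold G. now rewrite circ_closed.
    + apply (winds_ext (fun s => stereo (h (inv_stereo (circ c r s)))) _ (stereo (h (inv_stereo c)))).
      * intros s _. unfold G. now rewrite Rmult_0_l, planar_twist_0.
      * unfold cc. now rewrite Rmult_0_l, planar_twist_0.
      * apply Hw. lra.
Qed.

(* The isotopy is translated so as to keep the image of the centre [c] fixed. *)
Lemma orient_pres_sphere_twist_pre i a h :
  homeo h -> orient_pres h -> orient_pres (fun p => h (sphere_twist i a p)).
Proof.
  intros Hh Ho. apply orient_pres_chart. intros c Hc.
  assert (Mh := proj1 Hh). assert (Ch := proj1 (proj2 Hh)).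
  rewrite sphere_twist_inv_stereo in Hc.
  set (c1 := planar_twist i a c) in *.
  destruct (proj1 (orient_pres_chart h) Ho c1 Hc) as (r0 & Hr0 & Hw).
  destruct (homeo_pole_preimage h c1 Hh Hc) as (w0 & Hw0 & Hpre).
  (* [T 1] is the twist itself and [T 0] is the translation taking [c] to [c1], which turns circles
     about [c] into circles about [c1]; there the hypothesis on [h] applies. *)
  pose (T := fun t w => (fst (planar_twist i (t * a) w) - fst (planar_twist i (t * a) c) + fst c1,
                         snd (planar_twist i (t * a) w) - snd (planar_twist i (t * a) c) + snd c1)).
  (* [Q t] is the solution of [T t w = w0], the one plane point that could reach the pole at time
     [t]; [phi t] is its squared distance from [c]. *)
  pose (Q := fun t => planar_twist i (t * - a)
                (fst w0 + fst (planar_twist i (t * a) c) - fst c1,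
                 snd w0 + snd (planar_twist i (t * a) c) - snd c1)).
  pose (phi := fun t => (fst (Q t) - fst c) * (fst (Q t) - fst c) + (snd (Q t) - snd c) * (snd (Q t) - snd c)).
  assert (Hopp : forall t w, planar_twist i (t * a) (planar_twist i (t * - a) w) = w).
  { intros t w. rewrite planar_twist_plus. replace (t * a + t * - a) with 0 by ring. apply planar_twist_0. }
  assert (Hopp' : forall t w, planar_twist i (t * - a) (planar_twist i (t * a) w) = w).
  { intros t w. rewrite planar_twist_plus. replace (t * - a + t * a) with 0 by ring. apply planar_twist_0. }
  assert (Hphi : forall t, 0 < phi t).
  { intros t. apply sqdist_pos. intros E. apply Hw0.
    apply (f_equal (planar_twist i (t * a))) in E. unfold Q in E. rewrite Hopp in E.
    assert (F1 := f_equal fst E). assert (F2 := f_equal snd E).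
    rewrite (surjective_pairing w0), (surjective_pairing c1). cbn [fst snd] in F1, F2. f_equal; lra. }
  assert (Hcphi : forall t, continuity_pt phi t).
  { intros t. apply continuity_pt_filterlim.
    assert (HQ : continuous Q t).
    { apply continuous_planar_twist_comp; [ctn|].
      assert (continuous (fun t => planar_twist i (t * a) c) t) by (apply continuous_planar_twist_comp; ctn).
      ctn. }
    change (continuous phi t). unfold phi. ctn. }
  (* The forbidden point moves with [t]; compactness of the time interval gives one radius that
     avoids it throughout. *)
  destruct (continuity_ab_min phi 0 1 ltac:(lra) (fun t _ => Hcphi t)) as (mx & Hmin & _).
  assert (Hs : 0 < sqrt (phi mx)) by (apply sqrt_lt_R0, Hphi).
  exists (Rmin r0 (sqrt (phi mx))). split; [now apply Rmin_pos|]. intros r [Hr Hr'].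
  assert (Hrr0 : r < r0) by (eapply Rlt_le_trans; [exact Hr' | apply Rmin_l]).
  assert (HrD : r < sqrt (phi mx)) by (eapply Rlt_le_trans; [exact Hr' | apply Rmin_r]).
  assert (Hr2 : r * r < phi mx).
  { assert (E := sqrt_sqrt (phi mx) ltac:(left; apply Hphi)).
    apply Rlt_le_trans with (sqrt (phi mx) * sqrt (phi mx)); [apply Rmult_le_0_lt_compat|]; lra. }
  assert (Hav : forall t s, in01 t -> h (inv_stereo (T t (circ c r s))) <> Npole).
  { intros t s Ht E. apply Hpre in E.
    assert (E2 : circ c r s = Q t).
    { unfold Q. rewrite <- E. unfold T. cbn [fst snd].
      rewrite <- (Hopp' t (circ c r s)) at 1. f_equal.
      rewrite (surjective_pairing (planar_twist i (t * a) (circ c r s))) at 1. f_equal; ring. }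
    generalize (circ_sqdist c r s). rewrite E2. fold (phi t).
    specialize (Hmin t Ht). lra. }
  pose (G := fun t s => stereo (h (inv_stereo (T t (circ c r s))))).
  pose (cc := fun _ : R => stereo (h (inv_stereo c1))).
  apply (winds_ext (G 1) _ (cc 1)).
  - intros s _. unfold G, T. rewrite sphere_twist_inv_stereo, Rmult_1_l. fold c1. do 3 f_equal.
    rewrite (surjective_pairing (planar_twist i a (circ c r s))) at 3. f_equal; ring.
  - unfold cc. now rewrite sphere_twist_inv_stereo.
  - apply winds_homotopy.
    + intros t s Ht _. unfold G.
      apply continuous_stereo_comp; [|apply S2_height_neq1; [apply Mh, S2_inv_stereo | now apply Hav]].
      apply continuous_cont_S2_comp; [exact Ch | intros; apply S2_inv_stereo |].
      apply continuous_inv_stereo_comp. unfold T.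
      assert (continuous (fun z : R * R => planar_twist i (fst z * a) (circ c r (snd z))) (t, s)).
      { apply continuous_planar_twist_comp; [|unfold circ]; ctn. }
      assert (continuous (fun z : R * R => planar_twist i (fst z * a) c) (t, s)).
      { apply continuous_planar_twist_comp; ctn. }
      ctn.
    + intros t _. apply continuous_const.
    + intros t s Ht _ E. unfold G, cc in E. apply stereo_inj in E; auto; try apply Mh, S2_inv_stereo.
      apply homeo_inj in E; auto using S2_inv_stereo.
      apply inv_stereo_inj in E. unfold T in E.
      assert (E1 := f_equal fst E). assert (E2 := f_equal snd E). cbn [fst snd] in E1, E2.
      apply (circ_neq_center c r s Hr), (planar_twist_inj i (t * a)).
      rewrite (surjective_pairing (planar_twist i (t * a) (circ c r s))),
        (surjective_pairing (planar_twist i (t * a) c)). f_equal; lra.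
    + intros t _. unfold G. now rewrite circ_closed.
    + apply (winds_ext (fun s => stereo (h (inv_stereo (circ c1 r s)))) _ (stereo (h (inv_stereo c1)))).
      * intros s _. unfold G, T. rewrite Rmult_0_l, !planar_twist_0. do 3 f_equal.
        unfold circ. cbn [fst snd]. f_equal; ring.
      * reflexivity.
      * apply Hw. lra.
Qed.

(** * Words in the half-twists and their permutations *)

Definition swap (i j : nat) : nat :=
  if Nat.eqb j i then S i else if Nat.eqb j (S i) then i else j.

Definition swaps (l : list nat) (j : nat) : nat := fold_left (fun j i => swap i j) l j.

Definition twists (l : list nat) (p : pt) : pt := fold_left (fun p i => half_twist i p) l p.

Lemma twists_cons i l p : twists (i :: l) p = twists l (half_twist i p).
Proof. reflexivity. Qed.

Ltac swap_cases :=
  unfold swap; repeat match goal with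
  | |- context [Nat.eqb ?a ?b] => destruct (Nat.eqb_spec a b)
  end.

Lemma S2_q j : S2 (q j).
Proof. apply S2_inv_stereo. Qed.

(** The points [q i] and [q (S i)] lie at distance 1/2 from the centre, inside radius 3/5, where the
    twist is the point reflection. All others lie at distance at least 3/2, outside radius 7/10,
    where it is the identity. *)
Lemma half_twist_q i j : half_twist i (q j) = q (swap i j).
Proof.
  rewrite half_twistE. unfold q. rewrite sphere_twist_inv_stereo. f_equal.
  assert (Hnear : forall w, sqrt ((fst w - (INR i + / 2)) * (fst w - (INR i + / 2)) + snd w * snd w) = / 2 ->
            planar_twist i PI w = (2 * INR i + 1 - fst w, - snd w)).
  { intros w Hw. unfold planar_twist. cbv zeta. rewrite Hw. unfold twist_profile.
    destruct (Rle_dec (/ 2) (3 / 5)); [|lra]. rewrite Rmult_1_r, cos_PI, sin_PI. f_equal; field. }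
  swap_cases.
  - subst j. rewrite Hnear; cbn [fst snd].
    + rewrite S_INR. f_equal; ring.
    + transitivity (sqrt (/ 2 * / 2)); [f_equal; field | apply sqrt_square; lra].
  - subst j. rewrite Hnear; cbn [fst snd]; rewrite S_INR.
    + f_equal; ring.
    + transitivity (sqrt (/ 2 * / 2)); [f_equal; field | apply sqrt_square; lra].
  - apply planar_twist_far. cbn [fst snd].
    apply Rlt_le_trans with (sqrt (1 * 1)); [rewrite sqrt_square; lra|].
    apply sqrt_le_1_alt.
    assert (H : INR j <= INR i - 1 \/ INR i + 2 <= INR j).
    { assert (Hji : (S j <= i \/ S (S i) <= j)%nat) by lia.
      destruct Hji as [H|H]; apply le_INR in H; rewrite ?S_INR in H; [left | right]; lra. }
    destruct H; nra.
Qed.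

Lemma twists_q l j : twists l (q j) = q (swaps l j).
Proof.
  revert j. induction l as [|i l IH]; intros j; [reflexivity|].
  rewrite twists_cons, half_twist_q. apply IH.
Qed.

Lemma swaps_app l l' j : swaps (l ++ l') j = swaps l' (swaps l j).
Proof. apply fold_left_app. Qed.

Lemma swap_involutive i j : swap i (swap i j) = j.
Proof.
  unfold swap at 2. destruct (Nat.eqb_spec j i); [|destruct (Nat.eqb_spec j (S i))]; swap_cases; lia.
Qed.

(** Each transposition is its own inverse. This holds for the permutations only: [twists (rev l)]
    does not in general invert [twists l]. *)
Lemma swaps_rev l j : swaps (rev l) (swaps l j) = j.
Proof.
  revert j. induction l as [|i l IH]; intros j; [reflexivity|].
  simpl. rewrite swaps_app, IH. apply swap_involutive.
Qed.

Lemma swaps_inj l j j' : swaps l j = swaps l j' -> j = j'.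
Proof. intros H. now rewrite <- (swaps_rev l j), H, swaps_rev. Qed.

Lemma swaps_range n l j :
  (forall i, In i l -> (1 <= i <= n - 1)%nat) -> (1 <= j <= n)%nat -> (1 <= swaps l j <= n)%nat.
Proof.
  revert j. induction l as [|i l IH]; intros j Hl Hj; [exact Hj|].
  simpl. apply IH; [intros; apply Hl; now right|].
  specialize (Hl i (or_introl eq_refl)). swap_cases; lia.
Qed.

Lemma swaps_fix l j : (forall i, In i l -> (j < i \/ S i < j)%nat) -> swaps l j = j.
Proof.
  induction l as [|i l IH]; intros Hl; [reflexivity|]. simpl.
  replace (swap i j) with j; [apply IH; intros; apply Hl; now right|].
  specialize (Hl i (or_introl eq_refl)). swap_cases; lia.
Qed.

Lemma homeo_id : homeo (fun p => p).
Proof.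
  assert (C : cont_S2 (fun p => p)).
  { intros p _ eps He. exists eps. split; [exact He | auto]. }
  assert (M : maps_S2 (fun p => p)) by exact (fun p Hp => Hp).
  split; [exact M|]. split; [exact C|]. exists (fun p => p). auto.
Qed.

(** The inverse runs through the twists of angle [- PI] in reverse order. The last clause is proved
    along the word, each letter costing one composition with a single twist before or after [h]. *)
Lemma twists_inverse l :
  exists g, homeo g /\ (forall p, S2 p -> g (twists l p) = p /\ twists l (g p) = p) /\
    (forall h, homeo h -> orient_pres h ->
       orient_pres (fun p => h (g p)) /\ orient_pres (fun p => g (h p))).
Proof.
  induction l as [|i l (g & Hg & Hinv & Ho)].
  - exists (fun p => p). split; [exact homeo_id|]. split; [split; reflexivity | split; assumption].
  - exists (fun p => sphere_twist i (- PI) (g p)).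
    assert (Hs := homeo_sphere_twist i (- PI)).
    split; [now apply homeo_comp|]. split.
    + intros p Hp. rewrite !twists_cons, !half_twistE. split.
      * rewrite (proj1 (Hinv _ (maps_S2_sphere_twist i PI p Hp))). now apply sphere_twist_opp.
      * rewrite sphere_twist_opp'; [|now apply (proj1 Hg)]. now apply Hinv.
    + intros h Hh Hoh. split.
      * apply (Ho (fun p => h (sphere_twist i (- PI) p))); [now apply homeo_comp|].
        now apply orient_pres_sphere_twist_pre.
      * apply orient_pres_sphere_twist_post; [now apply homeo_comp | now apply Ho].
Qed.

(** The indices spelled by the descending blocks; the ascending blocks spell the reversed word for
    [j], by [asc_blocks]. The length [S (i r) - r] vanishes for an empty block. *)
Definition desc_word (k : nat) (i : nat -> nat) : list nat :=
  flat_map (fun r => rev (seq r (S (i r) - r))) (seq 1 k).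

Lemma flat_map_map {A B C : Type} (f : B -> C) (g : A -> list B) l :
  flat_map (fun r => map f (g r)) l = map f (flat_map g l).
Proof. induction l as [|a l IH]; [reflexivity|]. simpl. now rewrite IH, map_app. Qed.

Lemma rev_flat_map_rev {A B : Type} (f : A -> list B) l :
  rev (flat_map (fun r => rev (f r)) l) = flat_map f (rev l).
Proof.
  induction l as [|a l IH]; [reflexivity|]. simpl.
  rewrite rev_app_distr, rev_involutive, IH, flat_map_app. simpl. now rewrite app_nil_r.
Qed.

Lemma desc_blocks n k i : flat_map (fun r => desc_block n r (i r)) (seq 1 k) = map (sigma n) (desc_word k i).
Proof. apply flat_map_map. Qed.

Lemma asc_blocks n k j :
  flat_map (fun r => asc_block n r (j r)) (rev (seq 1 k)) = map (sigma n) (rev (desc_word k j)).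
Proof. unfold desc_word, asc_block. rewrite rev_flat_map_rev. apply flat_map_map. Qed.

Lemma In_desc_word n k i x :
  (forall r, (1 <= r <= k)%nat -> (i r <= n - 1)%nat) -> In x (desc_word k i) -> (1 <= x <= n - 1)%nat.
Proof.
  intros Hi Hx. apply in_flat_map in Hx. destruct Hx as (r & Hr & Hx).
  rewrite in_seq in Hr. rewrite <- in_rev, in_seq in Hx. specialize (Hi r ltac:(lia)). lia.
Qed.

Lemma swaps_desc_run s d : swaps (rev (seq s d)) (s + d) = s.
Proof.
  induction d as [|d IH]; [simpl; lia|].
  rewrite seq_S, rev_app_distr. simpl. replace (swap (s + d) (s + S d)) with (s + d)%nat; [exact IH|].
  swap_cases; lia.
Qed.

(** A block [s < r] moves only points up to [i s + 1], hence not [i r + 1]; block [r] brings that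
    point down to [r]; the later blocks use indices above [r] and leave it there. *)
Lemma swaps_desc_word k i r :
  (forall r, (1 <= r < k)%nat -> (i r < i (S r))%nat) -> (1 <= r <= k)%nat ->
  swaps (desc_word k i) (S (i r)) = r.
Proof.
  intros Hinc. unfold desc_word.
  (* Induction on the number [m] of blocks from [s] on. The bound [s <= S (i s)], inherited from the
     strict increase of [i], keeps the truncated subtraction exact. *)
  assert (Hgen : forall m s, (1 <= s)%nat -> (s + m = S k)%nat ->
     (s <= k -> s <= S (i s))%nat ->
     forall r, (s <= r <= k)%nat -> (s < r -> i s < i r)%nat /\
       swaps (flat_map (fun r => rev (seq r (S (i r) - r))) (seq s m)) (S (i r)) = r).
  { induction m as [|m IH]; intros s Hs Hm Hle r0 Hr; [lia|].
    assert (Hmon : (s < r0 -> i s < i r0)%nat).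
    { intros Hlt. assert (Hstep := Hinc s ltac:(lia)).
      destruct (Nat.eq_dec r0 (S s)) as [->|]; [exact Hstep|].
      destruct (IH (S s) ltac:(lia) ltac:(lia) ltac:(lia) r0 ltac:(lia)) as [H _]. lia. }
    split; [exact Hmon|]. cbn [seq flat_map]. rewrite swaps_app.
    destruct (Nat.eq_dec r0 s) as [->|Hne].
    - replace (swaps (rev (seq s (S (i s) - s))) (S (i s))) with s
        by (rewrite <- (swaps_desc_run s (S (i s) - s)) at 1; f_equal; lia).
      apply swaps_fix. intros x Hx. left. apply in_flat_map in Hx. destruct Hx as (y & Hy & Hx).
      rewrite in_seq in Hy. rewrite <- in_rev, in_seq in Hx. lia.
    - rewrite (swaps_fix (rev _)).
      + assert (Hstep := Hinc s ltac:(lia)). apply IH; lia.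
      + intros x Hx. rewrite <- in_rev, in_seq in Hx. specialize (Hmon ltac:(lia)). lia. }
  intros Hr. apply (Hgen k 1%nat); lia.
Qed.

Lemma swaps_asc_word k i r :
  (forall r, (1 <= r < k)%nat -> (i r < i (S r))%nat) -> (1 <= r <= k)%nat ->
  swaps (rev (desc_word k i)) r = S (i r).
Proof. intros Hi Hr. rewrite <- (swaps_desc_word k i r Hi Hr) at 1. apply swaps_rev. Qed.

Lemma between_true a b i : between a b i = true <-> (a <= i <= b)%nat.
Proof. unfold between. now rewrite Bool.andb_true_iff, !Nat.leb_le. Qed.

(** The range hypotheses keep every intermediate point in {1..n}, outside which [sigma] is
    undefined. *)
Lemma pb_fold_sigma n l e a :
  (forall i, In i l -> (1 <= i <= n - 1)%nat) ->
  (forall b, pb e a = Some b -> (1 <= b <= n)%nat) ->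
  pb (fold_left mulIM (map (sigma n) l) e) a = option_map (swaps l) (pb e a).
Proof.
  revert e. induction l as [|i l IH]; intros e Hl He.
  - simpl. now destruct (pb e a).
  - simpl. assert (Hi := Hl i (or_introl eq_refl)).
    assert (E : pb (mulIM e (sigma n i)) a = option_map (swap i) (pb e a)).
    { simpl. destruct (pb e a) as [b|]; [|reflexivity].
      now rewrite (proj2 (between_true 1 n b)) by auto. }
    rewrite IH, E.
    + now destruct (pb e a).
    + intros; apply Hl; now right.
    + rewrite E. intros b. destruct (pb e a) as [c|]; [|discriminate]. simpl. intros H. injection H as <-.
      apply (swaps_range n (i :: nil)); [|now apply He]. intros x [<-|[]]. exact Hi.
Qed.

Lemma hm_fold_sigma n l e p :
  hm (fold_left mulIM (map (sigma n) l) e) p = twists l (hm e p).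
Proof. revert e. induction l as [|i l IH]; intros e; [reflexivity|]. simpl. now rewrite IH. Qed.

Lemma hm_normal_form n k i j x p :
  hm (normal_form n k i j x) p = twists (rev (desc_word k j)) (hm x (twists (desc_word k i) p)).
Proof.
  unfold normal_form, prodIM. rewrite desc_blocks, asc_blocks, !fold_left_app, hm_fold_sigma. simpl.
  now rewrite hm_fold_sigma.
Qed.

(** The outer words permute {1..n}. Between them [eps_from k] keeps only what the descending word
    brings into {1..k}, and injectivity identifies the origins of these points as the [S (i r)]. *)
Lemma pb_normal_form n k i j x a b :
  (1 <= n)%nat -> nf_data n k i j x ->
  pb (normal_form n k i j x) a = Some b <->
  exists r s, (1 <= r <= k)%nat /\ pb x r = Some s /\ a = S (i r) /\ b = S (j s).
Proof.
  intros Hn (Hk & Hinc & Hle & ((Hrange & _) & _) & _).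
  assert (Hi : forall r, (1 <= r < k)%nat -> (i r < i (S r))%nat) by (intros r Hr; apply (Hinc r Hr)).
  assert (Hj : forall r, (1 <= r < k)%nat -> (j r < j (S r))%nat) by (intros r Hr; apply (Hinc r Hr)).
  assert (HD : forall y, In y (desc_word k i) -> (1 <= y <= n - 1)%nat).
  { intros y. apply In_desc_word. intros r Hr. apply (Hle r Hr). }
  assert (HA : forall y, In y (rev (desc_word k j)) -> (1 <= y <= n - 1)%nat).
  { intros y. rewrite <- in_rev. apply In_desc_word. intros r Hr. apply (Hle r Hr). }
  unfold normal_form, prodIM. rewrite desc_blocks, asc_blocks, !fold_left_app.
  set (e1 := fold_left mulIM (map (sigma n) (desc_word k i)) (oneIM n)).
  assert (E1 : pb e1 a = if between 1 n a then Some (swaps (desc_word k i) a) else None).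
  { unfold e1. rewrite pb_fold_sigma; [|exact HD|]; simpl.
    - now destruct (between 1 n a).
    - intros c. destruct (between 1 n a) eqn:E; [|discriminate]. intros H; injection H as <-.
      now apply between_true. }
  set (e2 := fold_left mulIM (eps_from k :: x :: eps_from k :: nil) e1).
  assert (E2 : forall s, pb e2 a = Some s <-> exists r, (1 <= r <= k)%nat /\ pb x r = Some s /\ a = S (i r)).
  { intros s. unfold e2. cbn [fold_left mulIM pb eps_from]. rewrite E1. split.
    - destruct (between 1 n a) eqn:Ea; [|discriminate].
      destruct (between 1 k (swaps (desc_word k i) a)) eqn:Eu; [|discriminate].
      destruct (pb x (swaps (desc_word k i) a)) as [v|] eqn:Ev; [|discriminate].
      destruct (between 1 k v); [|discriminate]. intros H; injection H as <-.
      apply between_true in Eu. exists (swaps (desc_word k i) a). repeat split; try assumption; try apply Eu.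
      apply (swaps_inj (desc_word k i)). now rewrite swaps_desc_word.
    - intros (r & Hr & Hx & ->). destruct (Hle r Hr) as [Hir _].
      rewrite (proj2 (between_true 1 n _)) by lia. rewrite swaps_desc_word by assumption.
      rewrite (proj2 (between_true 1 k _)) by lia. rewrite Hx.
      now rewrite (proj2 (between_true 1 k _)) by apply (Hrange r s Hx). }
  rewrite pb_fold_sigma; [|exact HA|].
  - split.
    + destruct (pb e2 a) as [s|] eqn:Es; [|discriminate]. simpl. intros H; injection H as <-.
      destruct (proj1 (E2 s) eq_refl) as (r & Hr & Hx & Ha). exists r, s. repeat split; try assumption; try lia.
      apply swaps_asc_word; [exact Hj | apply (Hrange r s Hx)].
    + intros (r & s & Hr & Hx & Ha & ->). rewrite (proj2 (E2 s)) by (exists r; auto). simpl.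
      f_equal. apply swaps_asc_word; [exact Hj | apply (Hrange r s Hx)].
  - intros s Hs. apply E2 in Hs. destruct Hs as (r & _ & Hx & _). specialize (Hrange r s Hx). lia.
Qed.

(** * Increasing enumerations of finite sets and counting arguments *)

Lemma increasing_lt k (f : nat -> nat) :
  (forall r, (1 <= r < k)%nat -> (f r < f (S r))%nat) ->
  forall r r', (1 <= r)%nat -> (r < r')%nat -> (r' <= k)%nat -> (f r < f r')%nat.
Proof.
  intros Hf r r' Hr Hlt. induction Hlt as [|m Hlt IH]; intros Hk; [apply Hf; lia|].
  specialize (IH ltac:(lia)). specialize (Hf m ltac:(lia)). lia.
Qed.

Lemma increasing_inj k (f : nat -> nat) :
  (forall r, (1 <= r < k)%nat -> (f r < f (S r))%nat) ->
  forall r r', (1 <= r <= k)%nat -> (1 <= r' <= k)%nat -> f r = f r' -> r = r'.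
Proof.
  intros Hf r r' Hr Hr' E. destruct (Nat.lt_total r r') as [H|[H|H]]; [|exact H|].
  - apply (increasing_lt k f Hf) in H; lia.
  - apply (increasing_lt k f Hf) in H; lia.
Qed.

(** Strong induction on the position [r]: once the earlier terms agree, the next term of either
    sequence is the least remaining element of the common set. *)
Lemma increasing_unique k1 k2 (f g : nat -> nat) :
  (forall r, (1 <= r < k1)%nat -> (f r < f (S r))%nat) ->
  (forall r, (1 <= r < k2)%nat -> (g r < g (S r))%nat) ->
  (forall r, (1 <= r <= k1)%nat -> exists s, (1 <= s <= k2)%nat /\ f r = g s) ->
  (forall s, (1 <= s <= k2)%nat -> exists r, (1 <= r <= k1)%nat /\ f r = g s) ->
  k1 = k2 /\ forall r, (1 <= r <= k1)%nat -> f r = g r.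
Proof.
  intros Hf Hg Hfg Hgf.
  assert (Hf' := increasing_lt k1 f Hf). assert (Hg' := increasing_lt k2 g Hg).
  assert (Hmain : forall r, (1 <= r)%nat ->
     ((r <= k1)%nat <-> (r <= k2)%nat) /\ ((r <= k1)%nat -> f r = g r)).
  { intros r. induction r as [r IH] using lt_wf_ind. intros Hr.
    (* A value shared with position [r] cannot sit at an earlier position of the other sequence,
       since there the two agree and the first would repeat a value. *)
    assert (Hge : forall s t, (1 <= s)%nat -> (1 <= t)%nat -> (s <= k1)%nat -> (t <= k2)%nat ->
               (s = r \/ t = r) -> f s = g t -> (r <= s /\ r <= t)%nat).
    { intros s t H1 H2 H3 H4 [-> | ->] E.
      - split; [lia|]. destruct (le_lt_dec r t) as [|Hlt]; [assumption|].
        destruct (IH t Hlt H2) as [Ht1 Ht2]. specialize (Hf' t r ltac:(lia) Hlt H3).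
        rewrite Ht2 in Hf' by tauto. lia.
      - split; [|lia]. destruct (le_lt_dec r s) as [|Hlt]; [assumption|].
        destruct (IH s Hlt H1) as [Ht1 Ht2]. specialize (Hg' s r ltac:(lia) Hlt H4).
        rewrite <- Ht2 in Hg' by tauto. lia. }
    split; [split|]; intros H.
    - destruct (Hfg r ltac:(lia)) as (t & Ht & E). destruct (Hge r t); try lia; auto.
    - destruct (Hgf r ltac:(lia)) as (t & Ht & E). destruct (Hge t r); try lia; auto.
    (* If both partners lay beyond [r], then [f r = g t > g r = f s > f r]. *)
    - destruct (Hfg r ltac:(lia)) as (t & Ht & E). destruct (Hge r t) as [_ Hrt]; try lia; auto.
      destruct (Hgf r ltac:(lia)) as (s & Hs & E'). destruct (Hge s r) as [Hrs _]; try lia; auto.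
      destruct (Nat.eq_dec r t) as [->|N1]; [exact E|].
      specialize (Hg' r t ltac:(lia) ltac:(lia) ltac:(lia)).
      destruct (Nat.eq_dec r s) as [->|N2]; [lia|].
      specialize (Hf' r s ltac:(lia) ltac:(lia) ltac:(lia)). lia. }
  split.
  - destruct (Nat.lt_total k1 k2) as [H|[H|H]]; [|exact H|].
    + destruct (Hmain k2 ltac:(lia)) as [E _]. lia.
    + destruct (Hmain k1 ltac:(lia)) as [E _]. lia.
  - intros r Hr. apply (Hmain r); lia.
Qed.

Lemma increasing_enum (n : nat) (P : nat -> bool) :
  exists k f, (k <= n)%nat /\ (forall r, (1 <= r < k)%nat -> (f r < f (S r))%nat) /\
    (forall r, (1 <= r <= k)%nat -> (1 <= f r <= n)%nat /\ P (f r) = true) /\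
    (forall a, (1 <= a <= n)%nat -> P a = true -> exists r, (1 <= r <= k)%nat /\ f r = a).
Proof.
  induction n as [|n (k & f & Hk & Hinc & Hf & Hsurj)].
  - exists 0%nat, (fun r => r). repeat split; intros; lia.
  - destruct (P (S n)) eqn:HP.
    + exists (S k), (fun r => if Nat.eqb r (S k) then S n else f r). split; [lia|]. split; [|split].
      * intros r Hr. destruct (Nat.eqb_spec r (S k)); [lia|]. destruct (Nat.eqb_spec (S r) (S k)).
        -- assert (H := proj1 (Hf r ltac:(lia))). lia.
        -- apply Hinc. lia.
      * intros r Hr. destruct (Nat.eqb_spec r (S k)); [split; [lia | exact HP]|].
        destruct (Hf r ltac:(lia)) as [H1 H2]. split; [lia | exact H2].
      * intros a Ha HPa. destruct (Nat.eq_dec a (S n)) as [->|Hne].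
        -- exists (S k). rewrite Nat.eqb_refl. split; [lia | reflexivity].
        -- destruct (Hsurj a ltac:(lia) HPa) as (r & Hr & E). exists r.
           destruct (Nat.eqb_spec r (S k)); [lia|]. split; [lia | exact E].
    + exists k, f. split; [lia|]. split; [exact Hinc|]. split.
      * intros r Hr. destruct (Hf r Hr). split; [lia | assumption].
      * intros a Ha HPa. destruct (Nat.eq_dec a (S n)) as [->|Hne]; [congruence|].
        apply Hsurj; [lia | exact HPa].
Qed.

Lemma finite_choice (k : nat) (R : nat -> nat -> Prop) :
  (forall r, (1 <= r <= k)%nat -> exists s, R r s) ->
  exists f, forall r, (1 <= r <= k)%nat -> R r (f r).
Proof.
  induction k as [|k IH]; intros H; [exists (fun r => r); intros; lia|].
  destruct IH as [f Hf]; [intros; apply H; lia|]. destruct (H (S k) ltac:(lia)) as [s Hs].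
  exists (fun r => if Nat.eqb r (S k) then s else f r). intros r Hr.
  destruct (Nat.eqb_spec r (S k)) as [->|]; [exact Hs | apply Hf; lia].
Qed.

Lemma NoDup_map_seq k (f : nat -> nat) :
  (forall r r', (1 <= r <= k)%nat -> (1 <= r' <= k)%nat -> f r = f r' -> r = r') ->
  NoDup (map f (seq 1 k)).
Proof.
  intros H. apply NoDup_map_NoDup_ForallPairs; [|apply seq_NoDup].
  intros r r' Hr Hr'. rewrite in_seq in Hr, Hr'. apply H; lia.
Qed.

Lemma injective_le k1 k2 (f : nat -> nat) :
  (forall r, (1 <= r <= k1)%nat -> (1 <= f r <= k2)%nat) ->
  (forall r r', (1 <= r <= k1)%nat -> (1 <= r' <= k1)%nat -> f r = f r' -> r = r') ->
  (k1 <= k2)%nat.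
Proof.
  intros Hf Hi. apply NoDup_map_seq in Hi.
  apply NoDup_incl_length with (l' := seq 1 k2) in Hi; [now rewrite length_map, !length_seq in Hi|].
  intros y Hy. apply in_map_iff in Hy. destruct Hy as (r & <- & Hr). rewrite in_seq in Hr.
  specialize (Hf r ltac:(lia)). rewrite in_seq. lia.
Qed.

Lemma injective_surjective k (f : nat -> nat) :
  (forall r, (1 <= r <= k)%nat -> (1 <= f r <= k)%nat) ->
  (forall r r', (1 <= r <= k)%nat -> (1 <= r' <= k)%nat -> f r = f r' -> r = r') ->
  forall s, (1 <= s <= k)%nat -> exists r, (1 <= r <= k)%nat /\ f r = s.
Proof.
  intros Hf Hi s Hs. apply NoDup_map_seq in Hi.
  apply NoDup_length_incl with (l' := seq 1 k) in Hi.
  - assert (Hin : In s (seq 1 k)) by (rewrite in_seq; lia).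
    apply Hi, in_map_iff in Hin. destruct Hin as (r & E & Hr). rewrite in_seq in Hr.
    exists r. split; [lia | exact E].
  - now rewrite length_map, !length_seq.
  - intros y Hy. apply in_map_iff in Hy. destruct Hy as (r & <- & Hr). rewrite in_seq in Hr.
    specialize (Hf r ltac:(lia)). rewrite in_seq. lia.
Qed.

Lemma validM_surjective k x s :
  validM k x -> (1 <= s <= k)%nat -> exists r, (1 <= r <= k)%nat /\ pb x r = Some s.
Proof.
  intros (((Hr & Hinj) & _) & Htot) Hs.
  destruct (finite_choice k (fun r s => pb x r = Some s) Htot) as [f Hf].
  destruct (injective_surjective k f) with (s := s) as (r & Hr' & E); [| |exact Hs|].
  - intros r Hrk. apply (Hr r (f r)); auto.
  - intros r r' Hrk Hrk' E. apply (Hinj r r' (f r)); [auto | rewrite E; auto].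
  - exists r. split; [exact Hr' | rewrite <- E; auto].
Qed.

Lemma desc_word_ext k i i' :
  (forall r, (1 <= r <= k)%nat -> i r = i' r) -> desc_word k i = desc_word k i'.
Proof.
  intros H. unfold desc_word. rewrite !flat_map_concat_map. f_equal. apply map_ext_in.
  intros r Hr. rewrite in_seq in Hr. now rewrite H by lia.
Qed.

(** Prepares the data of the normal form: [a] lists the domain, [b] the range, and [f] is the
    permutation of positions that becomes the partial bijection of [x]. The two lists have equal
    length because [t] gives injections of positions both ways. *)
Lemma pbij_enum n (t : nat -> option nat) :
  pbij n t ->
  exists k a b f, (k <= n)%nat /\
    (forall r, (1 <= r < k)%nat -> (a r < a (S r))%nat /\ (b r < b (S r))%nat) /\
    (forall r, (1 <= r <= k)%nat -> (1 <= a r <= n)%nat /\ (1 <= b r <= n)%nat) /\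
    (forall r, (1 <= r <= k)%nat -> (1 <= f r <= k)%nat /\ t (a r) = Some (b (f r))) /\
    (forall x y, t x = Some y -> exists r, (1 <= r <= k)%nat /\ a r = x).
Proof.
  intros (Hrange & Hinj).
  destruct (increasing_enum n (fun x => match t x with Some _ => true | None => false end))
    as (k & a & Hk & Ha & Har & Has).
  destruct (increasing_enum n (fun y => existsb (fun x => match t x with Some z => Nat.eqb z y | None => false end) (seq 1 n)))
    as (k' & b & Hk' & Hb & Hbr & Hbs).
  assert (Hab : forall r, (1 <= r <= k)%nat -> exists s, (1 <= s <= k')%nat /\ t (a r) = Some (b s)).
  { intros r Hr. destruct (Har r Hr) as [H1 H2]. destruct (t (a r)) as [y|] eqn:E; [|discriminate].
    destruct (Hbs y) as (s & Hs & <-).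
    - apply (Hrange _ _ E).
    - apply existsb_exists. exists (a r). split; [rewrite in_seq; lia|]. rewrite E. apply Nat.eqb_refl.
    - exists s. auto. }
  assert (Hba : forall s, (1 <= s <= k')%nat -> exists r, (1 <= r <= k)%nat /\ t (a r) = Some (b s)).
  { intros s Hs. destruct (Hbr s Hs) as [H1 H2]. apply existsb_exists in H2. destruct H2 as (x & Hx & E).
    destruct (t x) as [z|] eqn:Et; [|discriminate]. apply Nat.eqb_eq in E. subst z.
    destruct (Has x) as (r & Hr & <-); [apply (Hrange _ _ Et) | now rewrite Et |]. exists r. auto. }
  apply finite_choice in Hab. destruct Hab as [f Hf].
  apply finite_choice in Hba. destruct Hba as [g Hg].
  assert (E1 : (k <= k')%nat).
  { apply (injective_le k k' f); [intros r Hr; apply (Hf r Hr)|]. intros r r' Hr Hr' E.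
    destruct (Hf r Hr) as [_ F]. destruct (Hf r' Hr') as [_ F']. rewrite <- E in F'.
    apply (increasing_inj k a Ha); auto. now apply (Hinj _ _ _ F). }
  assert (E2 : (k' <= k)%nat).
  { apply (injective_le k' k g); [intros r Hr; apply (Hg r Hr)|]. intros r r' Hr Hr' E.
    destruct (Hg r Hr) as [_ F]. destruct (Hg r' Hr') as [_ F']. rewrite <- E, F in F'. injection F' as F'.
    now apply (increasing_inj k' b Hb). }
  assert (k' = k) by lia. subst k'.
  exists k, a, b, f. split; [exact Hk|]. split; [auto|].
  split; [intros r Hr; split; [apply (Har r Hr) | apply (Hbr r Hr)]|]. split; [exact Hf|].
  intros x y E. destruct (Has x) as (r & Hr & <-); [apply (Hrange _ _ E) | now rewrite E |]. exists r. auto.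
Qed.

(** * Existence and uniqueness of the normal form *)

Lemma normal_form_exists (n : nat) (e : IMrep) :
  (1 <= n)%nat -> validIM n e ->
  exists k i j x, nf_data n k i j x /\ equivIM e (normal_form n k i j x).
Proof.
  intros Hn (Hpb & Hh & Ho & Hresp).
  destruct (pbij_enum n (pb e) Hpb) as (k & a & b & f & Hk & Hinc & Hran & Hf & Hdom).
  (* A block ending with index [m] moves the point [m + 1], hence the shift by one. *)
  pose (i := fun r => (a r - 1)%nat). pose (j := fun r => (b r - 1)%nat).
  assert (Ei : forall r, (1 <= r <= k)%nat -> S (i r) = a r) by (intros r Hr; specialize (Hran r Hr); unfold i; lia).
  assert (Ej : forall r, (1 <= r <= k)%nat -> S (j r) = b r) by (intros r Hr; specialize (Hran r Hr); unfold j; lia).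
  assert (Hij : forall r, (1 <= r < k)%nat -> (i r < i (S r))%nat /\ (j r < j (S r))%nat).
  { intros r Hr. specialize (Hinc r Hr). assert (H1 := Hran r ltac:(lia)).
    assert (H2 := Hran (S r) ltac:(lia)). unfold i, j. lia. }
  destruct (twists_inverse (desc_word k i)) as (g & Hg & Ig & Og).
  destruct (twists_inverse (rev (desc_word k j))) as (g' & Hg' & Ig' & Og').
  pose (x := mkIM (fun r => if between 1 k r then Some (f r) else None) (fun p => g' (hm e (g p)))).
  assert (Hx : forall r s, pb x r = Some s <-> (1 <= r <= k)%nat /\ s = f r).
  { intros r s. simpl. rewrite <- between_true. destruct (between 1 k r); split.
    - intros H; injection H as <-. auto.
    - intros [_ ->]. reflexivity.
    - discriminate.
    - intros [H _]. discriminate. }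
  assert (Hnf : nf_data n k i j x).
  { split; [exact Hk|]. split; [exact Hij|]. split.
    { intros r Hr. specialize (Hran r Hr). unfold i, j. lia. }
    split; [|intros r Hr; exists (f r); apply Hx; auto].
    split; [|split; [|split]].
    - split.
      + intros r s H. apply Hx in H. destruct H as [H ->]. split; [exact H | apply (Hf r H)].
      + intros r r' s H H'. apply Hx in H. apply Hx in H'. destruct H as [H ->], H' as [H' E].
        destruct (Hf r H) as [_ F]. destruct (Hf r' H') as [_ F']. rewrite <- E in F'.
        apply (increasing_inj k a (fun r Hr => proj1 (Hinc r Hr))); auto.
        destruct Hpb as [_ Hinj]. now apply (Hinj _ _ _ F).
    - apply (homeo_comp (fun p => hm e (g p)) g'); [|exact Hg']. now apply homeo_comp.
    - apply (Og' (fun p => hm e (g p))); [now apply homeo_comp | now apply Og].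
    - intros r s H. apply Hx in H. destruct H as [Hr ->]. destruct (Hf r Hr) as [Hfr F]. simpl.
      (* The descending word takes [q (a r)] to [q r], and [g] takes it back. *)
      replace (g (q r)) with (q (a r)).
      + rewrite (Hresp _ _ F), <- Ej by exact Hfr.
        rewrite <- (swaps_asc_word k j (f r) (fun r Hr => proj2 (Hij r Hr)) Hfr), <- twists_q.
        apply Ig', S2_q.
      + rewrite <- (swaps_desc_word k i r (fun r Hr => proj1 (Hij r Hr)) Hr) at 2.
        rewrite <- twists_q, (Ei r Hr). symmetry. apply Ig, S2_q. }
  exists k, i, j, x. split; [exact Hnf|]. split.
  - assert (Hiff : forall y z, pb e y = Some z <-> pb (normal_form n k i j x) y = Some z).
    { intros y z. rewrite (pb_normal_form n k i j x y z Hn Hnf). split.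
      - intros E. destruct (Hdom y z E) as (r & Hr & <-). destruct (Hf r Hr) as [Hfr F].
        exists r, (f r). split; [exact Hr|]. split; [apply Hx; auto|]. rewrite Ei, Ej by assumption.
        split; [reflexivity | congruence].
      - intros (r & s & Hr & H & -> & ->). apply Hx in H. destruct H as [_ ->].
        destruct (Hf r Hr) as [Hfr F]. now rewrite Ei, Ej by assumption. }
    intros y. destruct (pb e y) as [z|] eqn:E.
    + symmetry. now apply Hiff.
    + destruct (pb (normal_form n k i j x) y) as [z|] eqn:E'; [|reflexivity].
      apply Hiff in E'. congruence.
  (* The twists cancel against [g] and [g'] at every point of the sphere, so the constant isotopy
     suffices. *)
  - exists (fun _ => hm e). split; [|split; [|split]].
    + intros s p _ Hp eps He. destruct (proj1 (proj2 Hh) p Hp eps He) as (d & Hd & H).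
      exists d. split; [exact Hd|]. intros s' p' _ Hp' _ L. now apply H.
    + intros s _. split; assumption.
    + reflexivity.
    + intros p Hp. rewrite hm_normal_form. simpl.
      rewrite (proj1 (Ig p Hp)). symmetry. apply Ig'. now apply (proj1 Hh).
Qed.

(* With [hinv] inverse to [h], the formula [H2 s o hinv o H1 (1 - s)] joins the two end maps of
   isotopies [H1], [H2] issued from [h] without gluing them. *)
Lemma normal_form_core_unique (n k : nat) (i j i' j' : nat -> nat) (e x x' : IMrep) :
  (1 <= n)%nat -> validIM n e -> nf_data n k i j x -> nf_data n k i' j' x' ->
  (forall r, (1 <= r <= k)%nat -> i r = i' r /\ j r = j' r) ->
  equivIM e (normal_form n k i j x) -> equivIM e (normal_form n k i' j' x') -> equivIM x x'.
Proof.
  intros Hn (Hpb & Hh & _ & Hresp) Hnf Hnf' Hij (P1 & H1 & C1 & R1 & S1 & T1) (P2 & H2 & C2 & R2 & S2' & T2).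
  (* Equal indices spell equal words, so one pair [g], [g'] strips both normal forms to their
     cores. *)
  assert (HD : desc_word k i' = desc_word k i).
  { apply desc_word_ext. intros r Hr. symmetry. apply (Hij r Hr). }
  assert (HA : desc_word k j' = desc_word k j).
  { apply desc_word_ext. intros r Hr. symmetry. apply (Hij r Hr). }
  assert (Hmon : forall r, (1 <= r < k)%nat -> (i r < i (S r))%nat /\ (j r < j (S r))%nat) by apply Hnf.
  assert (Hxr : forall r s, pb x r = Some s -> (1 <= r <= k)%nat /\ (1 <= s <= k)%nat).
  { destruct Hnf as (_ & _ & _ & ((Hr & _) & _) & _). exact Hr. }
  assert (Hxr' : forall r s, pb x' r = Some s -> (1 <= r <= k)%nat /\ (1 <= s <= k)%nat).
  { destruct Hnf' as (_ & _ & _ & ((Hr & _) & _) & _). exact Hr. }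
  assert (Hx : forall r s, pb x r = Some s -> pb e (S (i r)) = Some (S (j s))).
  { intros r s H. rewrite P1. apply pb_normal_form; [exact Hn | exact Hnf |].
    exists r, s. repeat split; try assumption; apply (Hxr r s H). }
  assert (Hx' : forall r s, pb x' r = Some s -> pb e (S (i r)) = Some (S (j s))).
  { intros r s H. destruct (Hxr' r s H) as [Hr Hs].
    rewrite (proj1 (Hij r Hr)), (proj2 (Hij s Hs)), P2. apply pb_normal_form; [exact Hn | exact Hnf' |].
    exists r, s. auto. }
  destruct (twists_inverse (desc_word k i)) as (g & Hg & Ig & _).
  destruct (twists_inverse (rev (desc_word k j))) as (g' & Hg' & Ig' & _).
  assert (Mg := proj1 Hg). assert (Mh := proj1 Hh).
  assert (Hcore : forall y p, maps_S2 (hm y) -> S2 p ->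
            g' (twists (rev (desc_word k j)) (hm y (twists (desc_word k i) (g p)))) = hm y p).
  { intros y p My Hp. rewrite (proj2 (Ig p Hp)). apply Ig'. now apply My. }
  assert (Mx : maps_S2 (hm x)) by (destruct Hnf as (_ & _ & _ & (_ & (M & _) & _) & _); exact M).
  assert (Mx' : maps_S2 (hm x')) by (destruct Hnf' as (_ & _ & _ & (_ & (M & _) & _) & _); exact M).
  destruct Hh as (_ & Ch & hinv & Mi & Ci & L & R0).
  assert (Hhinv : homeo hinv).
  { split; [exact Mi|]. split; [exact Ci|]. exists (hm e). auto. }
  assert (I1 : forall s, in01 s -> in01 (1 - s)) by (unfold in01; intros; lra).
  split.
  (* Both cores are total on {1..k} and undefined elsewhere; at [r] the value of [pb e] fixes
     [S (j s)], hence [s]. *)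
  - intros r. destruct (pb x r) as [s|] eqn:E.
    + destruct (Hxr r s E) as [Hr Hs].
      destruct Hnf' as (_ & _ & _ & _ & Htot). destruct (Htot r Hr) as [s' E']. rewrite E'. f_equal.
      apply (increasing_inj k j (fun r Hr => proj2 (Hmon r Hr))); [exact Hs | apply (Hxr' r s' E') |].
      apply Hx in E. apply Hx' in E'. congruence.
    + destruct (pb x' r) as [s'|] eqn:E'; [|reflexivity].
      destruct (Hxr' r s' E') as [Hr _].
      destruct Hnf as (_ & _ & _ & _ & Htot). destruct (Htot r Hr) as [s E2]. congruence.
  - exists (fun s p => g' (H2 s (hinv (H1 (1 - s) (g p))))).
    split; [|split; [|split]].
    + intros s p Hs Hp eps He.
      assert (M1 := proj1 (proj1 (R1 (1 - s) (I1 s Hs))) _ (Mg p Hp)).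
      assert (M2 := proj1 (proj1 (R2 s Hs)) _ (Mi _ M1)).
      destruct (proj1 (proj2 Hg') _ M2 eps He) as (d1 & D1 & E1).
      destruct (C2 s _ Hs (Mi _ M1) d1 D1) as (d2 & D2 & E2).
      destruct (Ci _ M1 d2 D2) as (d3 & D3 & E3).
      destruct (C1 (1 - s) _ (I1 s Hs) (Mg p Hp) d3 D3) as (d4 & D4 & E4).
      destruct (proj1 (proj2 Hg) p Hp d4 D4) as (d5 & D5 & E5).
      exists (Rmin (Rmin d2 d4) d5). split; [repeat apply Rmin_pos; assumption|].
      intros s' p' Hs' Hp' Ls Lp.
      assert (Q1 := Rmin_l (Rmin d2 d4) d5). assert (Q2 := Rmin_r (Rmin d2 d4) d5).
      assert (Q3 := Rmin_l d2 d4). assert (Q4 := Rmin_r d2 d4).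
      assert (M1' := proj1 (proj1 (R1 (1 - s') (I1 s' Hs'))) _ (Mg p' Hp')).
      apply E1; [apply (proj1 (proj1 (R2 s' Hs'))), Mi, M1'|].
      apply E2; [exact Hs' | apply Mi, M1' | lra |].
      apply E3; [exact M1'|].
      apply E4; [now apply I1 | now apply Mg | |].
      * replace (1 - s - (1 - s')) with (- (s - s')) by ring. rewrite Rabs_Ropp. lra.
      * apply E5; [exact Hp' | lra].
    + intros s Hs. destruct (R1 (1 - s) (I1 s Hs)) as [Hm1 Rs1]. destruct (R2 s Hs) as [Hm2 Rs2]. split.
      * apply (homeo_comp (fun p => H2 s (hinv (H1 (1 - s) (g p)))) g'); [|exact Hg'].
        apply (homeo_comp (fun p => hinv (H1 (1 - s) (g p))) (H2 s)); [|exact Hm2].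
        apply (homeo_comp (fun p => H1 (1 - s) (g p)) hinv); [|exact Hhinv].
        now apply homeo_comp.
      (* The marked point travels from [q r] to [q (S (i r))] by [g], forward by [H1], back by
         [hinv], forward by [H2] to [q (S (j t))], and by [g'] to [q t]. *)
      * intros r t E. destruct (Hxr r t E) as [Hr Ht]. apply Hx in E.
        replace (g (q r)) with (q (S (i r))).
        -- rewrite (Rs1 _ _ E), <- (Hresp _ _ E), (L _ (S2_q _)), (Rs2 _ _ E).
           rewrite <- (swaps_asc_word k j t (fun r Hr => proj2 (Hmon r Hr)) Ht), <- twists_q.
           apply Ig', S2_q.
        -- rewrite <- (swaps_desc_word k i r (fun r Hr => proj1 (Hmon r Hr)) Hr) at 2.
           rewrite <- twists_q. symmetry. apply Ig, S2_q.
    + intros p Hp. rewrite Rminus_0_r, T1 by now apply Mg.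
      rewrite S2'; [|apply Mi; rewrite hm_normal_form, (proj2 (Ig p Hp))].
      * rewrite R0, hm_normal_form; [now apply Hcore|].
        rewrite <- T1 by now apply Mg. apply (proj1 (proj1 (R1 1 ltac:(unfold in01; lra)))). now apply Mg.
      * rewrite <- (proj2 (Ig p Hp)), <- hm_normal_form with (n := n), <- T1 by now apply Mg.
        apply (proj1 (proj1 (R1 1 ltac:(unfold in01; lra)))). now apply Mg.
    + intros p Hp. rewrite Rminus_diag, S1, L by now apply Mg.
      rewrite T2 by now apply Mg. rewrite hm_normal_form, HD, HA. now apply Hcore.
Qed.

Theorem theorem5p4 (n : nat) (Hn : (1 <= n)%nat) :
  forall e : IMrep, validIM n e ->
    (exists (k : nat) (i j : nat -> nat) (x : IMrep),
        nf_data n k i j x /\ equivIM e (normal_form n k i j x)) /\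
    (forall (k1 k2 : nat) (i1 j1 i2 j2 : nat -> nat) (x1 x2 : IMrep),
        nf_data n k1 i1 j1 x1 -> nf_data n k2 i2 j2 x2 ->
        equivIM e (normal_form n k1 i1 j1 x1) ->
        equivIM e (normal_form n k2 i2 j2 x2) ->
        k1 = k2 /\
        (forall r, (1 <= r <= k1)%nat -> i1 r = i2 r /\ j1 r = j2 r) /\
        equivIM x1 x2).
Proof.
  intros e He. split; [now apply normal_form_exists|].
  intros k1 k2 i1 j1 i2 j2 x1 x2 D1 D2 E1 E2.
  assert (Hpb : forall a b, pb (normal_form n k1 i1 j1 x1) a = Some b <->
                            pb (normal_form n k2 i2 j2 x2) a = Some b).
  { intros a b. now rewrite <- (proj1 E1), <- (proj1 E2). }
  (* Stated one-sidedly, to be used in both directions. The indices [i] are read from the domain;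
     for [j] every position must be a value of [x], which [validM_surjective] provides. *)
  assert (Hdom : forall k k' i j i' j' x x',
      nf_data n k i j x -> nf_data n k' i' j' x' ->
      (forall a b, pb (normal_form n k i j x) a = Some b -> pb (normal_form n k' i' j' x') a = Some b) ->
      (forall r, (1 <= r <= k)%nat -> exists s, (1 <= s <= k')%nat /\ i r = i' s) /\
      (forall r, (1 <= r <= k)%nat -> exists s, (1 <= s <= k')%nat /\ j r = j' s)).
  { intros k k' i j i' j' x x' D D' H. assert (V := proj2 (proj2 (proj2 D))).
    assert (V' := proj1 (proj1 (proj1 (proj2 (proj2 (proj2 D')))))). split; intros r Hr.
    - destruct (proj2 V r Hr) as [s Hs].
      destruct (proj1 (pb_normal_form n k' i' j' x' (S (i r)) (S (j s)) Hn D')) as (r' & s' & Hr' & _ & E & _).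
      { apply H, pb_normal_form; [exact Hn | exact D |]. exists r, s. auto. }
      exists r'. split; [exact Hr' | lia].
    - destruct (validM_surjective k x r V Hr) as (r0 & Hr0 & Hs).
      destruct (proj1 (pb_normal_form n k' i' j' x' (S (i r0)) (S (j r)) Hn D')) as (r' & s' & _ & Hs' & _ & E).
      { apply H, pb_normal_form; [exact Hn | exact D |]. exists r0, r. auto. }
      exists s'. split; [apply (V' r' s' Hs') | lia]. }
  destruct (Hdom _ _ _ _ _ _ _ _ D1 D2 (fun a b => proj1 (Hpb a b))) as [F1 F2].
  destruct (Hdom _ _ _ _ _ _ _ _ D2 D1 (fun a b => proj2 (Hpb a b))) as [G1 G2].
  assert (I1 := proj1 (proj2 D1)). assert (I2 := proj1 (proj2 D2)).
  destruct (increasing_unique k1 k2 i1 i2) as [Ek Ei]; [intros r Hr; apply (I1 r Hr) | intros r Hr; apply (I2 r Hr) | exact F1 | |].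
  { intros s Hs. destruct (G1 s Hs) as (r & Hr & E). exists r. auto. }
  destruct (increasing_unique k1 k2 j1 j2) as [_ Ej]; [intros r Hr; apply (I1 r Hr) | intros r Hr; apply (I2 r Hr) | exact F2 | |].
  { intros s Hs. destruct (G2 s Hs) as (r & Hr & E). exists r. auto. }
  subst k2. split; [reflexivity|]. split; [auto|].
  apply (normal_form_core_unique n k1 i1 j1 i2 j2 e); auto.
Qed.
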